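(* Let $H\in(0,1/2)$. There exists a positive constant $T_H$, depending only on $H$, such that for every $S>0$, every $c\in(0,S^H]$ and every $v\ge1$, $$\mathbf P\left(\left|\mathrm{UTV}^c(W^H,S)-\mathbf E\,\mathrm{UTV}^c(W^H,S)\right|>Sc^{1-\frac1H}v\right)\ge\frac12\exp\left(-T_H\,Sc^{-\frac1H}v^{1+2H}\right).$$
   Context: $W^H=(W^H_t)_{t\ge0}$ is a fractional Brownian motion with Hurst index $H\in(0,1)$, i.e. a centered Gaussian process with (a.s.) continuous trajectories and $\mathbf E(W^H_sW^H_t)=\frac12\{|s|^{2H}+|t|^{2H}-|t-s|^{2H}\}$ for $s,t\ge0$. For a path $f:[0,+\infty)\to\mathbb R$ that is right-continuous with left limits, $c\ge0$ and $0\le s<t$, the upward truncated variation is $$\mathrm{UTV}^c(f,[s,t])=\sup_{n\ge1}\ \sup_{s\le s_1<t_1<s_2<t_2<\dots<s_n<t_n\le t}\ \sum_{i=1}^n\left(f(t_i)-f(s_i)-c\right)_+,\qquad (x)_+=\max(x,0),$$ and $\mathrm{UTV}^c(f,S):=\mathrm{UTV}^c(f,[0,S])$ for $S>0$. *)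

(* Defs.v *)
From HB Require Import structures.
From mathcomp Require Import all_boot all_order all_algebra.
From mathcomp Require Import all_classical all_reals all_analysis.
Import Order.TTheory GRing.Theory Num.Theory.
Import numFieldNormedType.Exports.

Set Implicit Arguments.
Unset Strict Implicit.
Unset Printing Implicit Defensive.

Local Open Scope classical_set_scope.
Local Open Scope ring_scope.

(* [normal_prob m 0] is by convention the uniform law on [0, 1], hence the
   separate treatment of the degenerate Gaussian laws. *)
Definition gaussian_law (R : realType) (m sigma : R) (B : set R) : \bar R :=
  if sigma == 0 then dirac m B else normal_prob m sigma B.

Definition gaussian_variable (d : measure_display) (T : measurableType d)
    (R : realType) (P : probability T R) (X : T -> R) : Prop :=
  measurable_fun setT X /\
  exists m sigma : R, forall B : set R, measurable B ->
    P (X @^-1` B) = gaussian_law m sigma B.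

(* Processes are families [W : R -> T -> R] of which only the times [t >= 0]
   are ever considered. *)
Definition gaussian_process (d : measure_display) (T : measurableType d)
    (R : realType) (P : probability T R) (W : R -> T -> R) : Prop :=
  forall (n : nat) (t a : 'I_n -> R), (forall i, 0 <= t i) ->
    gaussian_variable P (fun w => \sum_(i < n) a i * W (t i) w).

Record fractional_brownian_motion (d : measure_display) (T : measurableType d)
    (R : realType) (P : probability T R) (H : R) (W : R -> T -> R) : Prop := {
  fbm_hurst : 0 < H < 1 ;
  fbm_gaussian : gaussian_process P W ;
  fbm_centered : forall t, 0 <= t -> ('E_P[W t] = 0)%E ;
  fbm_covariance : forall s t, 0 <= s -> 0 <= t ->
    ('E_P[fun w => (W s w * W t w)%R] =
     (2^-1 * (`|s| `^ (2 * H) + `|t| `^ (2 * H) - `|t - s| `^ (2 * H)))%:E)%E ;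
  fbm_continuous :
    {ae P, forall w, {within `[0, +oo[, continuous (fun t => W t w)}}
}.

(* UTV^c(f, [s, t]): the n intervals are [a i, b i] for i < n. The supremum is
   taken in the extended reals; for s < t it is over a nonempty family of
   nonnegative numbers. *)
Definition UTV (R : realType) (c : R) (f : R -> R) (s t : R) : \bar R :=
  ereal_sup [set x | exists n (a b : nat -> R),
    [/\ (0 < n)%N,
        s <= a 0%N, b n.-1 <= t,
        (forall i, (i < n)%N -> a i < b i) &
        (forall i, (i.+1 < n)%N -> b i < a i.+1)] /\
    x = (\sum_(i < n) Num.max (f (b i) - f (a i) - c) 0)%:E].

(* When trajectories are only almost surely continuous, an event defined by
   UTV need only be measurable for the completion of P. The inner probability
   is P on measurable events ([inner_probE]) and the completed probability on
   events of the completion ([inner_prob_completion]). *)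
Definition inner_prob (d : measure_display) (T : measurableType d)
    (R : realType) (P : probability T R) (E : set T) : \bar R :=
  ereal_sup [set P A | A in [set A | measurable A /\ A `<=` E]].

Lemma inner_prob_completion (d : measure_display) (T : measurableType d)
    (R : realType) (P : probability T R) (E A : set T) :
  measurable A -> P.-negligible ((E `\` A) `|` (A `\` E)) ->
  inner_prob P E = P A.
Proof.
move=> mA [N [mN PN0 EAN]]; apply/eqP; rewrite eq_le; apply/andP; split.
  apply: ge_ereal_sup => _ [B [mB BE] <-].
  rewrite -(measureU0 mA mN PN0) le_measure ?inE//; first exact: measurableU.
  move=> x /BE Ex; have [Ax|nAx] := pselect (A x); first by left.
  by right; apply: EAN; left.
apply: le_trans (_ : P (A `\` N) <= _)%E; last first.
  apply: ereal_sup_ubound; exists (A `\` N) => //; split.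
    exact: measurableD.
  by move=> x [Ax nNx]; apply: contrapT => nEx; apply/nNx/EAN; right.
rewrite -(measureU0 (measurableD mA mN) mN PN0) le_measure ?inE//.
  by apply: measurableU => //; exact: measurableD.
by move=> x Ax; have [Nx|nNx] := pselect (N x); [right|left].
Qed.

Lemma inner_probE (d : measure_display) (T : measurableType d)
    (R : realType) (P : probability T R) (E : set T) :
  measurable E -> inner_prob P E = P E.
Proof.
move=> mE; apply: inner_prob_completion => //.
by rewrite setDv setU0; exact: negligible_set0.
Qed.

(* Main.v *)
(* An upper bound E UTV^c(W, S) <= C S c^(1-1/H) reduces the theorem to a
   Gaussian lower tail: for deterministic intervals [a_i, b_i], i < n, the
   variable UTV^c(W, S) dominates G - n c, where G = sum_i (W(b_i) - W(a_i)) is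
   centered Gaussian.  Taking n of order S c^(-1/H) v alternating intervals of
   length dlt = S/(2n), concavity of t^(2H) gives Var G >= (2 - 2^(2H)) n dlt^(2H),
   and exceeding E UTV + S c^(1-1/H) v + n c then costs a number of standard
   deviations whose square is of order S c^(-1/H) v^(1+2H).

   For the expectation, write W as its piecewise constant interpolation at mesh
   c^(1/H) plus the successive dyadic corrections; the truncation budget c is
   shared between the levels in geometric proportion r^k with r = 2^(-H/2), so
   that the correction at level k, of size c r^(2k), exceeds its share only with
   probability exp(-const r^(-k)), which beats the 2^k cells of that level. *)
Require Import Defs.
From HB Require Import structures.
From mathcomp Require Import all_boot all_order all_algebra.
From mathcomp Require Import all_classical all_reals all_analysis.
From mathcomp Require Import measurable_realfun zify ring lra.
Import Order.TTheory GRing.Theory Num.Theory.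
Import numFieldNormedType.Exports.

Local Open Scope classical_set_scope.
Local Open Scope ring_scope.

Set Implicit Arguments.
Unset Strict Implicit.
Unset Printing Implicit Defensive.

(** * Gaussian variables *)

(** By change of variables the left side is the integral of [f] against the Radon-Nikodym
    derivative, which agrees almost everywhere with [normal_pdf] because both have the same integral
    over every measurable set. *)
Lemma ge0_integral_normal_prob (R : realType) (m s : R) (f : _ -> \bar R) :
  measurable_fun setT f -> (forall x, 0 <= f x)%E ->
  (\int[normal_prob m s]_x f x =
   \int[lebesgue_measure]_x (f x * (normal_pdf m s x)%:E))%E.
Proof.
move=> mf f0.
have dom := @normal_prob_dominates R m s.
have := @Radon_Nikodym_SigmaFinite.change_of_variables _ _ R
  (normal_prob m s) lebesgue_measure dom f setT f0 measurableT mf.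
move=> <-.
have ig := Radon_Nikodym_SigmaFinite.f_integrable dom.
have mp : measurable_fun setT (fun x => (normal_pdf m s x)%:E).
  by apply/measurable_EFinP; exact: measurable_normal_pdf.
apply: ae_eq_integral => //.
- by apply: emeasurable_funM => //; exact: measurable_int ig.
- by apply: emeasurable_funM.
- apply: ae_eqe_mul2l.
  apply: integral_ae_eq => //.
  move=> A _ mA; rewrite -(Radon_Nikodym_SigmaFinite.f_integral dom mA).
  by [].
Qed.

Lemma measurable_expRM (R : realType) (l : R) :
  measurable_fun [set: R] (fun x : R => (expR (l * x))%:E).
Proof.
apply/measurable_EFinP; exact: measurableT_comp.
Qed.

(** Completing the square: exp (l x) times the density with mean [m] is the stated constant times
    the density with mean m + l s^2. *)
Lemma normal_mgf (R : realType) (m s l : R) : s != 0 ->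
  (\int[normal_prob m s]_x (expR (l * x))%:E =
   (expR (l * m + l ^+ 2 * s ^+ 2 / 2))%:E)%E.
Proof.
move=> s0; rewrite ge0_integral_normal_prob; last 2 first.
- exact: measurable_expRM.
- by move=> x; rewrite lee_fin expR_ge0.
transitivity (\int[lebesgue_measure]_x
   ((expR (l * m + l ^+ 2 * s ^+ 2 / 2))%:E *
    (normal_pdf (m + l * s ^+ 2) s x)%:E))%E.
  apply: eq_integral => x _; rewrite -!EFinM; congr EFin.
  rewrite !normal_pdfE //= mulrCA [RHS]mulrCA; congr (_ * _).
  rewrite /normal_fun -!expRD; congr expR.
  by field.
rewrite ge0_integralZl_EFin ?expR_ge0 //.
- by rewrite integral_normal_pdf mule1.
- by move=> x _; rewrite lee_fin normal_pdf_ge0.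
- by apply/measurable_EFinP; exact: measurable_normal_pdf.
Qed.

Lemma ge0_integral_gaussian (d : measure_display) (T : measurableType d)
    (R : realType) (P : probability T R) (X : T -> R) (m s : R)
    (f : _ -> \bar R) :
  measurable_fun setT X ->
  (forall B, measurable B -> P (X @^-1` B) = gaussian_law m s B) -> s != 0 ->
  measurable_fun setT f -> (forall x, 0 <= f x)%E ->
  (\int[P]_w f (X w) = \int[normal_prob m s]_x f x)%E.
Proof.
move=> mX lX s0 mf f0.
pose Y : T -> measurableTypeR R := X.
have mY : measurable_fun setT Y by [].
transitivity (\int[pushforward P Y]_x f x)%E.
  by rewrite ge0_integral_pushforward// => x _.
apply: eq_measure_integral => A mA _.
by have := lX A mA; rewrite /gaussian_law (negbTE s0).
Qed.

(** The sum of exponentials is 2 + (e^(x/2) - e^(-x/2))^2, and for x >= 0 the difference is at least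
    x/2 since e^(x/2) >= 1 + x/2 and e^(-x/2) <= 1. *)
Lemma expRDexpRN_ge (R : realType) (x : R) :
  2 + x ^+ 2 / 4 <= expR x + expR (- x).
Proof.
wlog x0 : x / 0 <= x.
  move=> h; have [/h//|/ltW x0] := leP 0 x.
  by have := h (- x); rewrite oppr_ge0 opprK sqrrN addrC => /(_ x0); lra.
pose e := expR (x / 2).
have e0 : 0 < e by exact: expR_gt0.
have e1 : 1 + x / 2 <= e by exact: expR_ge1Dx.
have -> : expR x = e * e by rewrite -expRD; congr expR; field.
have -> : expR (- x) = e^-1 * e^-1.
  by rewrite -expRN -expRD; congr expR; field.
have : x / 2 <= e - e^-1.
  have : e^-1 <= 1.
    by rewrite invf_le1// (le_trans _ e1)// lerDl; lra.
  lra.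
have ee : e * e^-1 = 1 by rewrite divff// gt_eqF.
move: (e^-1) ee => f ee h.
have := ler_pM (_ : 0 <= x / 2) (_ : 0 <= x / 2) h h.
by rewrite expr2; nra.
Qed.

Lemma expR_half_le2 (R : realType) : expR (2^-1 : R) <= 2.
Proof.
have := expR_ge1Dx (- (2^-1) : R); rewrite expRN.
have := expR_gt0 (2^-1 : R); move: (expR _) => e e0 h.
have : 2^-1 <= e^-1 by lra.
by rewrite lef_pV2 ?posrE.
Qed.

Section gaussian_variables.
Variables (d : measure_display) (T : measurableType d) (R : realType).
Variables (P : probability T R) (X : T -> R).
Hypothesis mX : measurable_fun setT X.

(** In the degenerate case X = m almost surely and the integrand is almost everywhere constant;
    otherwise [normal_mgf] transfers along the law. *)
Lemma gaussian_mgf (m s l : R) :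
  (forall B, measurable B -> P (X @^-1` B) = gaussian_law m s B) ->
  (\int[P]_w (expR (l * X w))%:E =
   (expR (l * m + l ^+ 2 * s ^+ 2 / 2))%:E)%E.
Proof.
move=> lX; have [s0|s0] := eqVneq s 0; last first.
  rewrite -normal_mgf//.
  apply: (@ge0_integral_gaussian _ _ _ P X m s (fun x : R => (expR (l * x))%:E) mX lX s0).
    exact: measurable_expRM.
  by move=> x; rewrite lee_fin expR_ge0.
have mXm : measurable (X @^-1` [set m]) by rewrite -[_ @^-1` _]setTI; exact: mX.
have Pm : P (~` (X @^-1` [set m])) = 0%E.
  rewrite probability_setC// lX// /gaussian_law s0 eqxx diracE mem_set// subee//.
transitivity (\int[P]_w (cst (expR (l * m))%:E) w)%E.
  apply: ae_eq_integral => //.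
    exact: (measurableT_comp (measurable_expRM l) mX).
  exists (~` (X @^-1` [set m])); split => //; first exact: measurableC.
  by move=> w /= /[swap] ->; apply => _.
rewrite integral_cst// [X in (_ * X)%E]probability_setT mule1.
by rewrite s0 expr0n /= mulr0 mul0r addr0.
Qed.

Lemma measurable_expRMX (l : R) :
  measurable_fun setT (fun w => (expR (l * X w))%:E).
Proof. exact: (measurableT_comp (measurable_expRM l) mX). Qed.

Lemma integrable_of_sqr :
  (\int[P]_w ((X w) ^+ 2)%:E < +oo)%E -> P.-integrable setT (EFin \o X).
Proof.
move=> X2; have mX2 : measurable_fun setT (fun w => (X w ^+ 2)%:E).
  by apply/measurable_EFinP; exact: measurable_funX.
apply: (@le_integrable _ _ _ P _ measurableT _ (fun w => (1 + X w ^+ 2)%:E)).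
- exact/measurable_EFinP.
- move=> w _; rewrite /= lee_fin [leRHS]ger0_norm ?addr_ge0 ?sqr_ge0//.
  have : 0 <= (`|X w| - 2^-1) ^+ 2 by exact: sqr_ge0.
  have -> : X w ^+ 2 = `|X w| ^+ 2 by rewrite real_normK ?num_real.
  by move: `|X w| => x; rewrite !expr2; nra.
- under [X in P.-integrable _ X]eq_fun do rewrite EFinD.
  apply: integrableD => //; first exact: finite_measure_integrable_cst.
  apply/integrableP; split => //.
  by under eq_integral do rewrite gee0_abs ?lee_fin ?sqr_ge0//.
Qed.

(* [E exp (l X) >= 1 + l E X] for all [l] forces the linear term of the
   log-moment generating function to vanish. *)
Lemma gaussian_centered (m s tau : R) :
  (forall B, measurable B -> P (X @^-1` B) = gaussian_law m s B) ->
  (\int[P]_w (X w)%:E = 0)%E ->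
  (\int[P]_w ((X w) ^+ 2)%:E = (tau ^+ 2)%:E)%E ->
  m = 0.
Proof.
move=> lX X0 X2.
have iX : P.-integrable setT (EFin \o X).
  by apply: integrable_of_sqr; rewrite X2 ltry.
have key l : 0 <= l * m + l ^+ 2 * s ^+ 2 / 2.
  rewrite leNgt -expR_lt1 -leNgt -lee_fin -(gaussian_mgf l lX).
  apply: (@le_trans _ _ (\int[P]_w ((cst 1%:E \+ (fun w => l%:E * (X w)%:E)) w))%E).
    rewrite integralD//=; last 2 first.
    - exact: finite_measure_integrable_cst.
    - exact: integrableZl.
    rewrite integral_cst// [X in (_ * X + _)%E]probability_setT.
    by rewrite integralZl// X0 mule0 adde0 mule1.
  apply: le_integral => //.
  - by apply: integrableD => //; [exact: finite_measure_integrable_cst|exact: integrableZl].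
  - apply/integrableP; split; first exact: measurable_expRMX.
    under eq_integral do rewrite gee0_abs ?lee_fin ?expR_ge0//.
    by rewrite (gaussian_mgf _ lX) ltry.
  - by move=> w _; rewrite /= lee_fin expR_ge1Dx.
apply/eqP; apply/negPn/negP => m0.
have s1 : 0 < s ^+ 2 + 1 by rewrite ltr_wpDl ?sqr_ge0.
(* A perturbation of the minimizer - m / s^2 of the quadratic in [l], valid also for s = 0; the
   value there is negative when m != 0. *)
have := key (- m / (s ^+ 2 + 1)).
have -> : - m / (s ^+ 2 + 1) * m + (- m / (s ^+ 2 + 1)) ^+ 2 * s ^+ 2 / 2 =
   - (m / (s ^+ 2 + 1)) ^+ 2 * (1 + s ^+ 2 / 2).
  by field; rewrite gt_eqF.
have : 0 < (m / (s ^+ 2 + 1)) ^+ 2.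
  by rewrite exprn_even_gt0//= mulf_neq0// invr_eq0 gt_eqF.
have : 0 <= s ^+ 2 by exact: sqr_ge0.
move: (s ^+ 2) (_ ^+ 2) => a b; nra.
Qed.

(* Compares [2 + (l X)^2 / 4 <= exp (l X) + exp (- l X)] in expectation at
   [l = 4 / tau]. *)
Lemma gaussian_sigma_ge (s tau : R) : 0 < tau ->
  (forall B, measurable B -> P (X @^-1` B) = gaussian_law 0 s B) ->
  (\int[P]_w ((X w) ^+ 2)%:E = (tau ^+ 2)%:E)%E ->
  tau ^+ 2 <= 16 * s ^+ 2.
Proof.
move=> t0 lX X2; rewrite leNgt; apply/negP => st.
have mX2 : measurable_fun setT (fun w => (X w ^+ 2)%:E).
  by apply/measurable_EFinP; exact: measurable_funX.
pose l := 4 / tau.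
have : (\int[P]_w (2%:E + (l ^+ 2 / 4)%:E * (X w ^+ 2)%:E) <=
   \int[P]_w ((expR (l * X w))%:E + (expR ((- l) * X w))%:E))%E.
  apply: ge0_le_integral => //.
  - move=> w _; rewrite -EFinM -EFinD lee_fin addr_ge0// mulr_ge0// ?sqr_ge0//.
    by rewrite mulr_ge0// sqr_ge0.
  - by apply: emeasurable_funD => //; apply: emeasurable_funM.
  - by apply: emeasurable_funD => //; exact: measurable_expRMX.
  - move=> w _; rewrite -EFinM -!EFinD lee_fin mulNr.
    by apply: le_trans (expRDexpRN_ge _); rewrite [(l * X w) ^+ 2]exprMn; lra.
rewrite ge0_integralD//; last 2 first.
- move=> w _; rewrite -EFinM lee_fin mulr_ge0// ?sqr_ge0//.
  by rewrite mulr_ge0// sqr_ge0.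
- exact: emeasurable_funM.
rewrite ge0_integralZl_EFin//; last 2 first.
- by move=> w _; rewrite lee_fin sqr_ge0.
- by rewrite mulr_ge0// sqr_ge0.
rewrite integral_cst// [X in (_ * X + _)%E]probability_setT mule1 X2.
have ge0e k (w : T) : setT w -> (0 <= (expR (k * X w))%:E)%E.
  by move=> _; rewrite lee_fin expR_ge0.
rewrite (ge0_integralD _ measurableT (ge0e l) (measurable_expRMX l)
  (ge0e (- l)) (measurable_expRMX (- l))).
rewrite !(gaussian_mgf _ lX) !mulr0 !add0r sqrrN -EFinM -!EFinD lee_fin.
(* The left side is 6, whereas 16 s^2 < tau^2 bounds the right side by 2 exp (1/2) <= 4. *)
have -> : 2 + l ^+ 2 / 4 * tau ^+ 2 = 6 by rewrite /l; field; rewrite gt_eqF.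
apply/negP; rewrite -ltNge.
have h : expR (l ^+ 2 * s ^+ 2 / 2) <= expR 2^-1.
  rewrite ler_expR.
  have t2 : 0 < tau ^+ 2 by rewrite exprn_gt0.
  have -> : l ^+ 2 * s ^+ 2 / 2 = 8 * s ^+ 2 / tau ^+ 2.
    by rewrite /l; field; rewrite gt_eqF.
  by rewrite ler_pdivrMr//; lra.
have := expR_half_le2 R; lra.
Qed.

End gaussian_variables.

Lemma normal_peak_sqr (R : realType) (s : R) : s != 0 ->
  s ^+ 2 * normal_peak s ^+ 2 = (pi * 2)^-1.
Proof.
move=> s0; have s2 : s ^+ 2 != 0 by rewrite expf_neq0.
have p0 : (pi : R) != 0 by rewrite gt_eqF// pi_gt0.
rewrite /normal_peak exprVn sqr_sqrtr; last first.
  by rewrite mulrn_wge0// mulr_ge0 ?sqr_ge0 ?pi_ge0.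
by rewrite -mulr_natr; move: (pi) p0 => q q0; field; rewrite q0.
Qed.

Lemma normal_prob_le_length (R : realType) (s a b : R) : s != 0 -> a <= b ->
  (normal_prob 0%R s `[a, b] <= (normal_peak s * (b - a))%:E)%E.
Proof.
move=> s0 ab; rewrite /normal_prob.
apply: (@le_trans _ _
  (\int[lebesgue_measure]_(x in `[a, b]) (normal_peak s)%:E)%E).
  apply: ge0_le_integral => //.
  - by move=> x _; rewrite lee_fin normal_pdf_ge0.
  - by apply/measurable_funTS/measurable_EFinP; exact: measurable_normal_pdf.
  - by move=> x _; rewrite lee_fin normal_pdf_ub.
rewrite integral_cst//= lebesgue_measure_itv/= lte_fin.
have [_|ba] := ltP a b; first by rewrite -EFinM.
by rewrite mule0 lee_fin mulr_ge0 ?normal_peak_ge0 ?subr_ge0.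
Qed.

(** Only the interval from y to y + |s| is kept. There x^2 <= 2 y^2 + 2 s^2 bounds the density
    below, and peak times length is 1 / sqrt (2 pi) >= 1/4. The second unit in the exponent serves
    to bring e^(-1) / 2 below 1/4. *)
Lemma normal_prob_tail_ge (R : realType) (s y : R) : s != 0 -> 0 <= y ->
  ((2^-1 * expR (- (2 + y ^+ 2 / s ^+ 2)))%:E <=
   normal_prob 0%R s `]y, +oo[)%E.
Proof.
move=> s0 y0.
have s0' : 0 < `|s| by rewrite normr_gt0.
have s2 : 0 < s ^+ 2 by rewrite exprn_even_gt0.
have : (normal_prob 0%R s `]y, (y + `|s|)%R] <= normal_prob 0%R s `]y, +oo[)%E.
  by apply: le_measure; rewrite ?inE// => x /=; rewrite !in_itv/= andbT => /andP[].
apply: le_trans; rewrite /normal_prob.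
pose k := normal_peak s * expR (- (1 + y ^+ 2 / s ^+ 2)).
apply: (@le_trans _ _
  (\int[lebesgue_measure]_(x in `]y, (y + `|s|)%R]) k%:E)%E); last first.
  apply: ge0_le_integral => //.
  - by move=> x _; rewrite lee_fin mulr_ge0 ?normal_peak_ge0 ?expR_ge0.
  - by apply/measurable_funTS/measurable_EFinP; exact: measurable_normal_pdf.
  - move=> x /=; rewrite in_itv/= => /andP[yx xs].
    rewrite lee_fin normal_pdfE//= ler_wpM2l ?normal_peak_ge0//.
    rewrite /normal_fun ler_expR subr0 -mulr_natr mulNr lerN2.
    rewrite ler_pdivrMr ?(mulr_gt0 s2)//.
    have -> : (1 + y ^+ 2 / s ^+ 2) * (s ^+ 2 * 2) = 2 * s ^+ 2 + 2 * y ^+ 2.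
      by field.
    have : x ^+ 2 <= (y + `|s|) ^+ 2.
      rewrite ler_pXn2r// nnegrE; first exact: ltW (le_lt_trans y0 yx).
      by rewrite addr_ge0.
    move/le_trans; apply.
    have : 0 <= (y - `|s|) ^+ 2 by exact: sqr_ge0.
    have -> : s ^+ 2 = `|s| ^+ 2 by rewrite real_normK ?num_real.
    by move: `|s| => t; rewrite !expr2; lra.
rewrite integral_cst//= lebesgue_measure_itv/= lte_fin ltrDl s0'.
rewrite -EFinB -EFinM lee_fin /k.
have -> : y + `|s| - y = `|s| by ring.
have -> : - (2 + y ^+ 2 / s ^+ 2) = - 1 + - (1 + y ^+ 2 / s ^+ 2) by ring.
rewrite expRD mulrA [leRHS]mulrAC ler_wpM2r ?expR_ge0//.
have e1 : expR (-1 : R) <= 2^-1.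
  rewrite expRN lef_pV2 ?posrE ?expR_gt0//.
  by have := expR_ge1Dx (1 : R); lra.
have : 4^-1 <= normal_peak s * `|s|.
  rewrite -(@ler_pXn2r _ 2) ?nnegrE ?mulr_ge0 ?normal_peak_ge0 ?invr_ge0//.
  rewrite exprMn real_normK ?num_real// mulrC normal_peak_sqr// exprVn.
  rewrite lef_pV2 ?posrE ?exprn_gt0 ?mulr_gt0 ?pi_gt0//.
  by have := pihalf_lt2 R; rewrite expr2; lra.
by have := expR_gt0 (-1 : R); lra.
Qed.

Section gaussian_variables.
Variables (d : measure_display) (T : measurableType d) (R : realType).
Variables (P : probability T R) (X : T -> R).
Hypothesis mX : measurable_fun setT X.

(* Chebyshev gives [P (|X| <= 2 tau) >= 3 / 4], while the density is at most
   [normal_peak s]. *)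
Lemma gaussian_sigma_le (s tau : R) : 0 < tau ->
  (forall B, measurable B -> P (X @^-1` B) = gaussian_law 0 s B) ->
  (\int[P]_w ((X w) ^+ 2)%:E = (tau ^+ 2)%:E)%E ->
  s ^+ 2 <= 16 * tau ^+ 2.
Proof.
move=> t0 lX X2; have [->|s0] := eqVneq s 0.
  by rewrite expr0n/= mulr_ge0// sqr_ge0.
have mX2 : measurable_fun setT (fun w => (X w ^+ 2)%:E).
  by apply/measurable_EFinP; exact: measurable_funX.
pose B : set R := `[- (2 * tau), 2 * tau]%classic.
have mB : measurable B by exact: measurable_itv.
have mXB : measurable (X @^-1` B) by rewrite -[_ @^-1` _]setTI; exact: mX.
have PB : (P (X @^-1` B) <= (normal_peak s * (4 * tau))%:E)%E.
  rewrite lX// /gaussian_law (negbTE s0).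
  have -> : 4 * tau = 2 * tau - - (2 * tau) by ring.
  by apply: normal_prob_le_length => //; lra.
have PA : ((4 * tau ^+ 2)%:E * P (~` (X @^-1` B)) <= (tau ^+ 2)%:E)%E.
  rewrite -X2 -[X in (_ * P X)%E]setIT -integral_indic//; last exact: measurableC.
  rewrite -ge0_integralZl_EFin//; last 2 first.
  - by apply/measurable_EFinP/measurable_indic; exact: measurableC.
  - by rewrite mulr_ge0// sqr_ge0.
  apply: ge0_le_integral => //.
  - move=> w _; rewrite -EFinM lee_fin; apply: mulr_ge0 => //.
    by apply: mulr_ge0 => //; exact: sqr_ge0.
  - apply: emeasurable_funM => //.
    by apply/measurable_EFinP/measurable_indic; exact: measurableC.
  - move=> w _; rewrite -EFinM lee_fin indicE.
    have [|] := boolP (w \in _); rewrite ?mulr0 ?sqr_ge0// mulr1.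
    rewrite inE /B /=.
    rewrite in_itv/= -ler_norml => /negP; rewrite -ltNge => h.
    rewrite -[leRHS]real_normK ?num_real//.
    have -> : 4 * tau ^+ 2 = (2 * tau) ^+ 2 by ring.
    by rewrite ler_pXn2r ?nnegrE// ?ltW// mulr_gt0.
move: PA; rewrite probability_setC//.
have fB : P (X @^-1` B) \is a fin_num by exact: fin_num_measure.
move: PB; rewrite -(fineK fB); set p := fine _.
rewrite lee_fin -EFinB -EFinM lee_fin => h1 h2.
have p0 : 0 <= p by exact: fine_ge0.
have t2 : 0 < tau ^+ 2 by rewrite exprn_gt0.
have p34 : 3 / 4 <= p by nra.
have : p ^+ 2 <= (normal_peak s * (4 * tau)) ^+ 2.
  by rewrite ler_pXn2r// ?nnegrE// (le_trans p0).
rewrite exprMn exprMn => h3.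
(* Here s^2 times the squared peak is 1 / (2 pi) <= 1/4; together with p^2 >= 9/16 this gives s^2 <=
   (64/9) tau^2. *)
have h4 : s ^+ 2 * p ^+ 2 <= 4 * tau ^+ 2.
  apply: (@le_trans _ _ ((s ^+ 2 * normal_peak s ^+ 2) * (4 ^+ 2 * tau ^+ 2))).
    by rewrite -mulrA ler_wpM2l ?sqr_ge0.
  rewrite normal_peak_sqr//.
  have : (pi * 2)^-1 <= 4^-1 :> R.
    by rewrite lef_pV2 ?posrE ?mulr_gt0 ?pi_gt0//; have := pi_ge2 R; lra.
  by rewrite [4 ^+ 2]expr2; nra.
have : 9 / 16 <= p ^+ 2 by rewrite expr2; nra.
have : 0 <= s ^+ 2 by exact: sqr_ge0.
by move: h4; move: (s ^+ 2) (p ^+ 2) => a b; nra.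
Qed.

(** Exponential Markov bound: the excess is at most tau exp ((|X| - c) / tau), and the moment
    generating function at 1/tau and -1/tau is at most e^8 because s^2 <= 16 tau^2. *)
Lemma gaussian_excess_le (s tau c : R) : 0 < tau ->
  (forall B, measurable B -> P (X @^-1` B) = gaussian_law 0 s B) ->
  (\int[P]_w ((X w) ^+ 2)%:E = (tau ^+ 2)%:E)%E ->
  (\int[P]_w (Num.max (`|X w| - c) 0)%:E <=
   (2 * expR 8 * tau * expR (- (c / tau)))%:E)%E.
Proof.
move=> t0 lX X2.
have st := gaussian_sigma_le t0 lX X2.
pose k := tau * expR (- (c / tau)).
have k0 : 0 <= k by rewrite mulr_ge0 ?expR_ge0// ltW.
have e0 l (w : T) : setT w -> (0 <= (expR (l * X w))%:E)%E.
  by move=> _; rewrite lee_fin expR_ge0.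
apply: (@le_trans _ _ (\int[P]_w (k%:E * ((expR (tau^-1 * X w))%:E +
    (expR (- tau^-1 * X w))%:E)))%E).
  apply: ge0_le_integral => //.
  - by move=> w _; rewrite lee_fin le_max lexx orbT.
  - apply/measurable_EFinP; apply: measurable_maxr => //.
    by apply: measurable_funB => //; exact: measurableT_comp.
  - apply: emeasurable_funM => //.
    by apply: emeasurable_funD => //; exact: measurable_expRMX.
  - move=> w _; rewrite -EFinD -EFinM lee_fin ge_max; apply/andP; split; last first.
      by rewrite mulr_ge0// addr_ge0 ?expR_ge0.
    apply: (@le_trans _ _ (k * expR (tau^-1 * `|X w|))).
      rewrite /k -mulrA -expRD -ler_pdivrMl//.
      apply: le_trans (expR_ge1Dx _); rewrite mulrBr.
      by rewrite [c / tau]mulrC; lra.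
    rewrite ler_wpM2l// mulNr.
    have := expR_ge0 (tau^-1 * X w); have := expR_ge0 (- (tau^-1 * X w)).
    by case: (ger0P (X w)) => _; rewrite ?mulrN; lra.
have me l := measurable_expRMX mX l.
rewrite ge0_integralZl_EFin//; last 2 first.
- by move=> w _; rewrite adde_ge0// lee_fin expR_ge0.
- by apply: emeasurable_funD; exact: me.
rewrite (ge0_integralD _ measurableT (e0 _) (me _) (e0 _) (me _)).
rewrite !(gaussian_mgf mX _ lX) !mulr0 !add0r sqrrN -EFinD -EFinM lee_fin.
have : expR (tau^-1 ^+ 2 * s ^+ 2 / 2) <= expR 8.
  rewrite ler_expR exprVn mulrC mulrA mulrC mulrA ler_pdivrMr ?exprn_gt0//.
  by lra.
move=> h; rewrite -[leRHS]mulrA -/k.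
apply: (@le_trans _ _ (k * (expR 8 + expR 8))); last by lra.
by rewrite ler_wpM2l// lerD.
Qed.

(** [gaussian_sigma_ge] both excludes the degenerate law and replaces [s] by the known standard
    deviation [tau], at the cost of the factor 16. *)
Lemma gaussian_tail_ge (s tau y : R) : 0 < tau -> 0 <= y ->
  (forall B, measurable B -> P (X @^-1` B) = gaussian_law 0 s B) ->
  (\int[P]_w ((X w) ^+ 2)%:E = (tau ^+ 2)%:E)%E ->
  ((2^-1 * expR (- (2 + 16 * y ^+ 2 / tau ^+ 2)))%:E <=
   P (X @^-1` `]y, +oo[))%E.
Proof.
move=> t0 y0 lX X2.
have st := gaussian_sigma_ge mX t0 lX X2.
have t2 : 0 < tau ^+ 2 by rewrite exprn_gt0.
have s2 : 0 < s ^+ 2 by lra.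
have s0 : s != 0 by apply: contraTneq s2 => ->; rewrite expr0n ltxx.
rewrite lX// /gaussian_law (negbTE s0).
apply: le_trans (normal_prob_tail_ge s0 y0).
rewrite lee_fin ler_wpM2l// ler_expR lerN2 lerD2l.
rewrite ler_pdivrMr// mulrAC ler_pdivlMr//.
have := sqr_ge0 y.
by move: (y ^+ 2) (s ^+ 2) (tau ^+ 2) st => a b e; nra.
Qed.

End gaussian_variables.

(** * Dyadic chaining for the truncated variation *)

(** Dropping the positive parts leaves a linear functional of the path, which is Gaussian for a
    Gaussian process. *)
Lemma UTV_ge (R : realType) (c : R) (f : R -> R) (s t : R) (n : nat)
    (a b : nat -> R) : (0 < n)%N -> s <= a 0%N -> b n.-1 <= t ->
  (forall i, (i < n)%N -> a i < b i) ->
  (forall i, (i.+1 < n)%N -> b i < a i.+1) ->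
  ((\sum_(i < n) (f (b i) - f (a i)) - n%:R * c)%:E <= UTV c f s t)%E.
Proof.
move=> n0 sa bt ab ba.
apply: (@le_trans _ _ (\sum_(i < n) Num.max (f (b i) - f (a i) - c) 0)%:E).
  rewrite lee_fin; apply: (@le_trans _ _ (\sum_(i < n) (f (b i) - f (a i) - c))).
    by rewrite [leRHS]big_split/= sumr_const card_ord mulr_natl mulNrn.
  by apply: ler_sum => i _; rewrite le_max lexx.
by apply: ereal_sup_ubound; exists n, a, b.
Qed.

Lemma UTV_ge0 (R : realType) (c : R) (f : R -> R) (s t : R) : s < t ->
  (0 <= UTV c f s t)%E.
Proof.
move=> st; apply: (@le_trans _ _
    (\sum_(i < 1) Num.max (f (cst t i) - f (cst s i) - c) 0)%:E).
  by rewrite lee_fin sumr_ge0// => i _; rewrite le_max lexx orbT.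
by apply: ereal_sup_ubound; exists 1%N, (cst s), (cst t).
Qed.

(** Non-overlapping index ranges are merged into one. The gaps may be empty, because disjoint
    intervals can round to a common grid index. *)
Lemma ler_sum_gaps (R : realType) (psi : nat -> R) (u w : nat -> nat) n :
  (forall j, 0 <= psi j) -> (forall i, (i < n.+1)%N -> (u i <= w i)%N) ->
  (forall i, (i < n)%N -> (w i <= u i.+1)%N) ->
  \sum_(i < n.+1) \sum_(u i <= j < w i) psi j <= \sum_(0 <= j < w n) psi j.
Proof.
move=> psi0; elim: n => [|n IH] uw wu.
  rewrite big_ord1 (big_cat_nat (leq0n (u 0%N)) (uw 0%N isT))//= lerDr.
  exact: sumr_ge0.
rewrite big_ord_recr/= [leRHS](big_cat_nat (leq0n (u n.+1)) (uw n.+1 (ltnSn _)))//= lerD2r.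
apply: (le_trans (IH _ _)) => [i ni|i ni|].
- by apply: uw; rewrite ltnS ltnW.
- by apply: wu; rewrite ltnS ltnW.
rewrite [leRHS](big_cat_nat (leq0n (w n)) (wu n (ltnSn _)))//= lerDl; exact: sumr_ge0.
Qed.

(** The excesses of [D u] and [D w] over c/2 are the first and last terms of the right-hand sum.
    Charging both ends of each cell [j] keeps the bound inside the range from [u] to [w], so that
    disjoint ranges can be added; for u = w the left side is -c. *)
Lemma ler_incr_excess (R : realType) (D : nat -> R) (c : R) (u w : nat) :
  0 <= c -> (u <= w)%N ->
  D w - D u - c <=
  \sum_(u <= j < w) (Num.max (`|D j| - c / 2) 0 + Num.max (`|D j.+1| - c / 2) 0).
Proof.
move=> c0; rewrite leq_eqVlt => /predU1P[->|uw].
  by rewrite big_geq// subrr sub0r oppr_le0.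
have h0 x : 0 <= Num.max (`|x| - c / 2) 0 by rewrite le_max lexx orbT.
rewrite big_split/= {1}(big_ltn uw); case: w uw => // w uw.
rewrite (@big_nat_recr _ _ _ w u)//=.
have h1 : `|D u| - c / 2 <= Num.max (`|D u| - c / 2) 0 by rewrite le_max lexx.
have h2 : `|D w.+1| - c / 2 <= Num.max (`|D w.+1| - c / 2) 0.
  by rewrite le_max lexx.
have s1 : 0 <= \sum_(u.+1 <= i < w.+1) Num.max (`|D i| - c / 2) 0.
  exact: sumr_ge0.
have s2 : 0 <= \sum_(u <= i < w) Num.max (`|D i.+1| - c / 2) 0.
  exact: sumr_ge0.
have := ler_norm (D w.+1); have := ler_norm (- D u); rewrite normrN.
by lra.
Qed.

Section dyadic.
Variables (R : realType) (dlt : R).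
Hypothesis dlt0 : 0 < dlt.

Definition dyadic_index (k : nat) (t : R) : nat :=
  Num.truncn (t / dlt * 2 ^+ k).

Definition dyadic_time (k j : nat) : R := j%:R * dlt / 2 ^+ k.

Lemma dyadic_time_ge0 k j : 0 <= dyadic_time k j.
Proof. by rewrite divr_ge0 ?mulr_ge0 ?exprn_ge0// ltW. Qed.

Lemma dyadic_time_double k j : dyadic_time k.+1 (j.*2) = dyadic_time k j.
Proof.
rewrite /dyadic_time -muln2 natrM exprS; field.
by rewrite expf_neq0.
Qed.

(** The parent of a cell is found by halving its index, which makes the corrections of successive
    levels telescope. *)
Lemma dyadic_index_half k t : 0 <= t ->
  (dyadic_index k.+1 t)./2 = dyadic_index k t.
Proof.
move=> t0; rewrite /dyadic_index exprS mulrCA; set y := t / dlt * _.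
have y0 : 0 <= y by rewrite mulr_ge0 ?divr_ge0 ?exprn_ge0// ltW.
have /andP[h1 h2] := truncn_itv (mulr_ge0 (ler0n R 2) y0).
apply/esym; apply: truncn_def; move: h1 h2; set m := Num.truncn _.
have := odd_double_half m; set q := m./2; rewrite -muln2 => <-.
rewrite -addn1 -[q.+1]addn1 !natrD !natrM.
by case: (odd m) => /=; lra.
Qed.

Lemma dyadic_time_index k t : 0 <= t ->
  t - dlt / 2 ^+ k <= dyadic_time k (dyadic_index k t) <= t.
Proof.
move=> t0; have p0 : 0 < (2 : R) ^+ k by rewrite exprn_gt0.
have y0 : 0 <= t / dlt * 2 ^+ k.
  by rewrite mulr_ge0 ?divr_ge0 ?exprn_ge0// ltW.
have /andP[] := truncn_itv y0; rewrite -/(dyadic_index k t) /dyadic_time.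
rewrite -(natr1 (dyadic_index k t)).
rewrite -[_ * dlt / _]mulrA; move: (dyadic_index k t)%:R => m.
have e0 : 0 < dlt / 2 ^+ k by rewrite divr_gt0.
have te : t = t / dlt * 2 ^+ k * (dlt / 2 ^+ k).
  by field; rewrite !gt_eqF.
move: (t / dlt * _) (dlt / _) e0 te => y e e0 te h1 h2.
have m1 : m * e <= y * e by rewrite ler_wpM2r// ltW.
have m2 : y * e <= (m + 1) * e.
  by rewrite ler_wpM2r ?ltW.
by rewrite te; apply/andP; split; lra.
Qed.

Lemma dyadic_index_le k t n : 0 <= t -> t <= n%:R * dlt ->
  (dyadic_index k t <= n * 2 ^ k)%N.
Proof.
move=> t0 tn; have <- : Num.truncn ((n * 2 ^ k)%N%:R : R) = (n * 2 ^ k)%N.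
  by rewrite natrK.
rewrite /dyadic_index; apply: le_truncn; rewrite natrM natrX.
by rewrite ler_wpM2r ?exprn_ge0// ler_pdivrMr.
Qed.

Lemma dyadic_index_mono k s t : s <= t ->
  (dyadic_index k s <= dyadic_index k t)%N.
Proof.
move=> st; apply: le_truncn; rewrite ler_wpM2r ?exprn_ge0//.
by rewrite ler_wpM2r// invr_ge0 ltW.
Qed.

Lemma cvg_dyadic_time t : 0 <= t ->
  dyadic_time k (dyadic_index k t) @[k --> \oo] --> t.
Proof.
move=> t0.
apply: (@squeeze_cvgr _ _ _ _ (fun k => t - dlt / 2 ^+ k) (cst t)).
- by apply: nearW => k; exact: dyadic_time_index.
- rewrite -[X in _ --> X]subr0; apply: cvgB; first exact: cvg_cst.
  have -> : (fun k => dlt / 2 ^+ k) = geometric dlt 2^-1.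
    by apply/funext => k; rewrite /geometric/= exprVn.
  by apply: cvg_geometric; rewrite ger0_norm//; lra.
- exact: cvg_cst.
Qed.

Lemma cvg_dyadic_fun (f : R -> R) t :
  {within `[0, +oo[, continuous f} -> 0 <= t ->
  f (dyadic_time k (dyadic_index k t)) @[k --> \oo] --> f t.
Proof.
move=> /subspace_continuousP cf t0.
have t0' : `[0, +oo[%classic t by rewrite /= in_itv/= t0.
have h := cf _ t0'.
apply: (cvg_comp (fun k => dyadic_time k (dyadic_index k t)) f _ h).
move=> B hB.
have : \forall k \near \oo, `[0, +oo[%classic (dyadic_time k (dyadic_index k t)) ->
    B (dyadic_time k (dyadic_index k t)) by exact: (cvg_dyadic_time t0 hB).
apply: filterS => k; apply; rewrite /= in_itv/= andbT.
exact: dyadic_time_ge0.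
Qed.

End dyadic.

(** The correction from mesh dlt / 2^k to the next: zero for even [j], and for odd [j] the increment
    over one cell of the finer grid. *)
Definition dyadic_fluct (R : realType) (dlt : R) (f : R -> R) (k j : nat) : R :=
  f (dyadic_time dlt k.+1 j) - f (dyadic_time dlt k j./2).

(** Level 0 is the whole variation along the coarse grid and gets no share of the truncation; level
    k + 1 spends the share [c_ k], half at each end of an interval. *)
Definition chaining_term (R : realType) (dlt : R) (c_ : nat -> R) (n0 : nat)
    (f : R -> R) (k : nat) : R :=
  if k is k'.+1 then
    \sum_(0 <= j < n0 * 2 ^ k)
      (Num.max (`|dyadic_fluct dlt f k' j| - c_ k' / 2) 0 +
       Num.max (`|dyadic_fluct dlt f k' j.+1| - c_ k' / 2) 0)
  else
    \sum_(0 <= j < n0) `|f (dyadic_time dlt 0 j.+1) - f (dyadic_time dlt 0 j)|.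

Section chaining.
Variables (R : realType) (dlt : R) (c : R) (c_ : nat -> R) (n0 : nat).
Variable f : R -> R.
Hypothesis dlt0 : 0 < dlt.
Hypothesis c_0 : forall k, 0 <= c_ k.
Hypothesis c_c : forall K, \sum_(k < K) c_ k <= c.

Let f_ K t := f (dyadic_time dlt K (dyadic_index dlt K t)).
Let Y := chaining_term dlt c_ n0 f.

Lemma chaining_term_ge0 k : 0 <= chaining_term dlt c_ n0 f k.
Proof.
case: k => [|k] /=; apply: sumr_ge0 => j _ //.
by rewrite addr_ge0// le_max lexx orbT.
Qed.

Let telescope_dyadic K t : 0 <= t ->
  f_ K t = f_ 0 t + \sum_(k < K) dyadic_fluct dlt f k (dyadic_index dlt k.+1 t).
Proof.
move=> t0; elim: K => [|K IH]; first by rewrite big_ord0 addr0.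
rewrite big_ord_recr/= addrA -IH /dyadic_fluct dyadic_index_half// /f_.
by rewrite addrC subrK.
Qed.

Let psi k j : R := if k is k'.+1 then
      (Num.max (`|dyadic_fluct dlt f k' j| - c_ k' / 2) 0 +
       Num.max (`|dyadic_fluct dlt f k' j.+1| - c_ k' / 2) 0)
  else `|f (dyadic_time dlt 0 j.+1) - f (dyadic_time dlt 0 j)|.

Let psi0 k j : 0 <= psi k j.
Proof. by case: k => //= k; rewrite addr_ge0// le_max lexx orbT. Qed.

Let YE k : Y k = \sum_(0 <= j < n0 * 2 ^ k) psi k j.
Proof. by case: k => //=; rewrite /Y /= expn0 muln1. Qed.

(** After telescoping, the coarse part is bounded by its variation and each correction absorbs its
    own share [c_ k] through [ler_incr_excess]; the shares add up to at most [c]. *)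
Let increment_le K s t : 0 <= s -> s <= t ->
  Num.max (f_ K t - f_ K s - c) 0 <=
  \sum_(k < K.+1) \sum_(dyadic_index dlt k s <= j < dyadic_index dlt k t) psi k j.
Proof.
move=> s0 st; have t0 : 0 <= t by exact: le_trans st.
rewrite ge_max; apply/andP; split; last by do 2 apply: sumr_ge0 => ? _.
rewrite (telescope_dyadic K t0) (telescope_dyadic K s0) big_ord_recl/=.
have h0 : f_ 0 t - f_ 0 s <= \sum_(dyadic_index dlt 0 s <= j < dyadic_index dlt 0 t) psi 0 j.
  rewrite /f_ -(telescope_sumr (fun j => f (dyadic_time dlt 0 j)))//; last first.
    exact: dyadic_index_mono.
  by apply: ler_sum => j _; exact: ler_norm.
have h1 : \sum_(k < K) (dyadic_fluct dlt f k (dyadic_index dlt k.+1 t) -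
    dyadic_fluct dlt f k (dyadic_index dlt k.+1 s) - c_ k) <=
    \sum_(k < K) \sum_(dyadic_index dlt k.+1 s <= j < dyadic_index dlt k.+1 t)
      psi k.+1 j.
  apply: ler_sum => k _; apply: ler_incr_excess => //.
  exact: dyadic_index_mono.
move: h1; rewrite !sumrB => h1; have := c_c K.
by move: h0 h1; rewrite /bump/=; lra.
Qed.

(** Exchanging the sums, the intervals occupy non-overlapping cells at each level, so the bound no
    longer depends on the partition. *)
Let partition_le K (n : nat) (a b : nat -> R) :
  (0 < n)%N -> 0 <= a 0%N -> b n.-1 <= n0%:R * dlt ->
  (forall i, (i < n)%N -> a i < b i) ->
  (forall i, (i.+1 < n)%N -> b i < a i.+1) ->
  \sum_(i < n) Num.max (f_ K (b i) - f_ K (a i) - c) 0 <= \sum_(k < K.+1) Y k.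
Proof.
case: n => // n _ a0 bn ab ba.
have ap i : (i <= n)%N -> 0 <= a i.
  elim: i => // i IH ni; apply: ltW; apply: (le_lt_trans (IH (ltnW ni))).
  by rewrite (lt_trans (ab i _))// ?ba// ltnS ltnW.
have bp i : (i <= n)%N -> 0 <= b i.
  by move=> ni; rewrite (le_trans (ap _ ni))// ltW// ab.
apply: (@le_trans _ _ (\sum_(i < n.+1) \sum_(k < K.+1)
   \sum_(dyadic_index dlt k (a i) <= j < dyadic_index dlt k (b i)) psi k j)).
  apply: ler_sum => i _; apply: increment_le; first by apply: ap; rewrite -ltnS.
  by apply/ltW/ab.
rewrite exchange_big/=; apply: ler_sum => k _.
apply: (@le_trans _ _ (\sum_(0 <= j < dyadic_index dlt k (b n)) psi k j)).
  apply: (@ler_sum_gaps _ (psi k) (fun i => dyadic_index dlt k (a i))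
    (fun i => dyadic_index dlt k (b i))) => //.
  - by move=> i ni; apply: dyadic_index_mono => //; exact/ltW/ab.
  - by move=> i ni; apply: dyadic_index_mono => //; exact/ltW/ba.
rewrite YE [leRHS](big_cat_nat (leq0n (dyadic_index dlt k (b n)))).
  by rewrite lerDl; exact: sumr_ge0.
by apply: dyadic_index_le => //; exact: bp.
Qed.

(** For a fixed partition the discretized sums converge to the true one by continuity, and the
    series dominates them all. *)
Lemma UTV_le_chaining : {within `[0, +oo[, continuous f} ->
  (UTV c f 0 (n0%:R * dlt) <=
   \sum_(0 <= k <oo) (chaining_term dlt c_ n0 f k)%:E)%E.
Proof.
move=> cf; apply: ge_ereal_sup => _ [n [a [b [[n1 a0 bn ab ba] ->]]]].
have part K : ((\sum_(k < K) Y k)%:E <= \sum_(0 <= k <oo) (Y k)%:E)%E.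
  apply: le_trans (nneseries_lim_ge K _); last first.
    by move=> k _ _; rewrite lee_fin chaining_term_ge0.
  by rewrite sumEFin lee_fin big_mkord.
(* An infinite series makes the bound trivial; a finite one turns it into an inequality between
   reals, to which limits apply. *)
have [foo|] := boolP (\sum_(0 <= k <oo) (Y k)%:E \is a fin_num)%E; last first.
  rewrite ge0_fin_numE; last first.
    by apply: nneseries_ge0 => k _ _; rewrite lee_fin chaining_term_ge0.
  by rewrite -leNgt leye_eq => /eqP; rewrite /Y => ->; exact: leey.
move: part; rewrite -/Y -(fineK foo) => part; rewrite lee_fin.
have ap i : (i < n)%N -> 0 <= a i.
  elim: i => // i IH ni; apply: ltW; apply: (le_lt_trans (IH (ltnW ni))).
  by rewrite (lt_trans (ab i _))// ?ba// ltnW.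
have bp i : (i < n)%N -> 0 <= b i.
  by move=> ni; rewrite (le_trans (ap _ ni))// ltW// ab.
have cvg_max0 (u : R^nat) l : u k @[k --> \oo] --> l ->
    Num.max (u k) 0 @[k --> \oo] --> Num.max l 0.
  move=> ul; apply: (cvg_comp u (fun x : R => Num.max x 0) ul).
  by apply: (@continuous_max R R id (cst 0)); [exact: cvg_id|exact: cvg_cst].
have cvg_part m : (m <= n)%N ->
  \sum_(i < m) Num.max (f_ K (b i) - f_ K (a i) - c) 0 @[K --> \oo] -->
  \sum_(i < m) Num.max (f (b i) - f (a i) - c) 0.
  elim: m => [_|m IH mn].
    under eq_fun do rewrite big_ord0.
    by rewrite big_ord0; exact: cvg_cst.
  under eq_fun do rewrite big_ord_recr/=.
  rewrite big_ord_recr/=; apply: cvgD; first exact: IH (ltnW mn).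
  apply: cvg_max0; apply: cvgB; last exact: cvg_cst.
  by apply: cvgB; apply: cvg_dyadic_fun => //; [exact: bp|exact: ap].
apply: (cvgr_to_le (cvg_part n (leqnn n))).
apply: nearW => K; rewrite -lee_fin; apply: le_trans (part K.+1).
by rewrite lee_fin; exact: partition_le.
Qed.

End chaining.

(** * Moments of fractional Brownian increments *)

Section fbm.
Variables (d : measure_display) (T : measurableType d) (R : realType).
Variables (P : probability T R) (H : R) (W : R -> T -> R).
Hypothesis fW : fractional_brownian_motion P H W.

Let cov (s t : R) : R :=
  2^-1 * (`|s| `^ (2 * H) + `|t| `^ (2 * H) - `|t - s| `^ (2 * H)).

Lemma fbm_measurable t : 0 <= t -> measurable_fun setT (W t).
Proof.
move=> t0; have [+ _] := fbm_gaussian fW (fun _ : 'I_1 => 1) (fun=> t0).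
by under eq_fun do rewrite big_ord1 mul1r.
Qed.

Lemma fbm_covE s t : 0 <= s -> 0 <= t ->
  (\int[P]_w (W s w * W t w)%:E = (cov s t)%:E)%E.
Proof. by move=> s0 t0; rewrite -(fbm_covariance fW s0 t0) unlock. Qed.

Lemma fbm_integrable_prod s t : 0 <= s -> 0 <= t ->
  P.-integrable setT (fun w => (W s w * W t w)%:E).
Proof.
move=> s0 t0; have m : measurable_fun setT (fun w => W s w * W t w).
  by apply: measurable_funM; exact: fbm_measurable.
apply/integrableP; split; first exact/measurable_EFinP.
by rewrite integral_fin_num_abs// fbm_covE.
Qed.

Lemma fbm_integrable t : 0 <= t -> P.-integrable setT (EFin \o W t).
Proof.
move=> t0; apply: integrable_of_sqr; first exact: fbm_measurable.
by under eq_integral do rewrite expr2; rewrite fbm_covE// ltry.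
Qed.

Lemma fbm_combination_mean n (t a : 'I_n -> R) : (forall i, 0 <= t i) ->
  (\int[P]_w (\sum_(i < n) a i * W (t i) w)%:E = 0)%E.
Proof.
move=> t0.
under eq_integral do rewrite -sumEFin.
rewrite integral_sum//; last first.
  by move=> i; under eq_fun do rewrite EFinM; apply: integrableZl => //;
    exact: fbm_integrable.
rewrite big1// => i _; under eq_integral do rewrite EFinM.
rewrite integralZl//; last exact: fbm_integrable.
by have := fbm_centered fW (t0 i); rewrite unlock => ->; rewrite mule0.
Qed.

Lemma fbm_combination_sqr n (t a : 'I_n -> R) : (forall i, 0 <= t i) ->
  (\int[P]_w ((\sum_(i < n) a i * W (t i) w) ^+ 2)%:E =
   (\sum_(i < n) \sum_(j < n) a i * a j * cov (t i) (t j))%:E)%E.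
Proof.
move=> t0.
have E w : ((\sum_(i < n) a i * W (t i) w) ^+ 2)%:E =
    (\sum_(i < n) \sum_(j < n) (a i * a j)%:E * (W (t i) w * W (t j) w)%:E)%E.
  rewrite expr2 mulr_suml -sumEFin; apply: eq_bigr => i _.
  rewrite mulr_sumr -sumEFin; apply: eq_bigr => j _.
  by rewrite -EFinM; congr EFin; ring.
under eq_integral do rewrite E.
have i1 i j : P.-integrable setT
    (fun w => ((a i * a j)%:E * (W (t i) w * W (t j) w)%:E)%E).
  by apply: integrableZl => //; exact: fbm_integrable_prod.
rewrite integral_sum//; last by move=> i; exact: integrable_sum.
rewrite -sumEFin; apply: eq_bigr => i _.
rewrite integral_sum// -sumEFin; apply: eq_bigr => j _.
rewrite integralZl//; last exact: fbm_integrable_prod.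
by rewrite fbm_covE// -EFinM.
Qed.

Lemma fbm_increments n (s t : 'I_n -> R) :
  (forall i, 0 <= s i) -> (forall i, 0 <= t i) ->
  let G := fun w => \sum_(i < n) (W (t i) w - W (s i) w) in
  [/\ gaussian_variable P G, (\int[P]_w (G w)%:E = 0)%E &
   (\int[P]_w ((G w) ^+ 2)%:E =
   (\sum_(i < n) \sum_(j < n) 2^-1 *
     (`|t j - s i| `^ (2 * H) + `|s j - t i| `^ (2 * H) -
      `|t j - t i| `^ (2 * H) - `|s j - s i| `^ (2 * H)))%:E)%E].
Proof.
move=> s0 t0 G.
(* Right endpoints with coefficient 1 come first, then left endpoints with coefficient -1; the
   one-point terms of [cov] cancel in the signed double sum. *)
pose u (k : 'I_(n + n)) : R :=
  match fintype.split k with inl i => t i | inr i => s i end.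
pose a (k : 'I_(n + n)) : R := match fintype.split k with inl _ => 1 | inr _ => - 1 end.
have u0 k : 0 <= u k by rewrite /u; case: (fintype.split k).
have spl i : fintype.split (lshift n i) = inl i :> 'I_n + 'I_n by exact: (unsplitK (inl i)).
have spr i : fintype.split (rshift n i) = inr i :> 'I_n + 'I_n by exact: (unsplitK (inr i)).
have GE : G = fun w => \sum_(k < n + n) a k * W (u k) w.
  apply/funext => w; rewrite big_split_ord/= /G big_split/=; congr (_ + _).
    by apply: eq_bigr => i _; rewrite /a /u spl mul1r.
  by apply: eq_bigr => i _; rewrite /a /u spr mulN1r.
split.
- by rewrite GE; exact: fbm_gaussian fW _ _ _ _.
- by rewrite GE; exact: fbm_combination_mean.
rewrite GE fbm_combination_sqr//; congr EFin.
rewrite big_split_ord/= -big_split/=; apply: eq_bigr => i _.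
rewrite !big_split_ord/= -!big_split/=; apply: eq_bigr => j _.
rewrite /a /u !spl !spr /cov; lra.
Qed.

Lemma fbm_increment s t : 0 <= s -> 0 <= t ->
  let G := fun w => W t w - W s w in
  [/\ gaussian_variable P G, (\int[P]_w (G w)%:E = 0)%E &
   (\int[P]_w ((G w) ^+ 2)%:E = ((`|t - s| `^ H) ^+ 2)%:E)%E].
Proof.
move=> s0 t0 G.
have [gG G0 G2] := @fbm_increments 1 (fun=> s) (fun=> t) (fun=> s0) (fun=> t0).
split.
- by move: gG; congr gaussian_variable; apply/funext => w; rewrite big_ord1.
- by rewrite -[RHS]G0; apply: eq_integral => w _; rewrite big_ord1.
have -> : (\int[P]_w ((G w) ^+ 2)%:E =
    \int[P]_w ((\sum_(i < 1) (W t w - W s w)) ^+ 2)%:E)%E.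
  by apply: eq_integral => w _; rewrite big_ord1.
rewrite G2 !big_ord1; congr EFin.
have /andP[H0 _] := fbm_hurst fW.
(* Zero to the power zero is 1, so the vanishing of the diagonal terms rests on this. *)
have H2 : 2 * H != 0 by rewrite mulf_neq0// gt_eqF.
rewrite !subrr normr0 powR0// !subr0 (distrC s t) -powR_mulrn ?powR_ge0//.
by rewrite -powRrM mulrC [H * _]mulrC; lra.
Qed.

End fbm.

(** Concavity of the power [al] is deduced from convexity of the inverse power 1/al, applied to the
    two values on the left. *)
Lemma powR_midpoint_concave (R : realType) (al : R) (m : nat) : 0 < al <= 1 ->
  m%:R `^ al + m.+2%:R `^ al <= 2 * m.+1%:R `^ al :> R.
Proof.
move=> /andP[a0 a1]; set x := m%:R `^ al; set y := m.+2%:R `^ al.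
have ap : 1 <= al^-1 by rewrite invf_ge1.
have an0 : al != 0 by rewrite gt_eqF.
have x0 : 0 <= x by exact: powR_ge0.
have y0 : 0 <= y by exact: powR_ge0.
have h01 : (0 <= 2^-1 :> R) && (2^-1 <= 1 :> R) by apply/andP; split; lra.
have := @convex_powR R al^-1 ap (@Itv01 R 2^-1 (proj1 (andP h01)) (proj2 (andP h01))) x y.
rewrite !inE/= !in_itv/= x0 y0 => /(_ isT isT).
rewrite convRE [X in X `^ _ <= _]convRE/= /x /y -!powRrM divff// !powRr1// -/x -/y => h.
have e : unstable.onem (2^-1 : R) = 2^-1 by rewrite /unstable.onem; lra.
move: h; rewrite e.
have -> : 2^-1 * m%:R + 2^-1 * m.+2%:R = m.+1%:R :> R.
  by rewrite -(natr1 m.+1) -(natr1 m); lra.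
have xy0 : 0 <= 2^-1 * x + 2^-1 * y by rewrite addr_ge0// mulr_ge0.
move=> h; have := @ge0_ler_powR R al (ltW a0) _ _ _ _ h.
rewrite !nnegrE powR_ge0 => /(_ isT (ler0n _ _)).
by rewrite -powRrM mulVf// powRr1//; lra.
Qed.

Section alternating_variance.
Variables (R : realType) (al dlt : R).
Hypothesis al01 : 0 < al <= 1.
Hypothesis dlt0 : 0 < dlt.

Let q (m : nat) : R := m%:R `^ al.
Let s (i : nat) : R := i.*2%:R * dlt.
Let t (i : nat) : R := i.*2.+1%:R * dlt.
(** For al = 2H, the covariance of the increments over [s i, t i] and [s j, t j], in the form given
    by [fbm_increments]. *)
Let C (i j : nat) : R := 2^-1 *
  (`|t j - s i| `^ al + `|s j - t i| `^ al - `|t j - t i| `^ al - `|s j - s i| `^ al).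

Let C_sym i j : C i j = C j i.
Proof.
by rewrite /C (distrC (t j) (s i)) (distrC (s j) (t i)) (distrC (t j))
  (distrC (s j) (s i)); lra.
Qed.

Let al_neq0 : al != 0. Proof. by case/andP: al01 => a0 _; rewrite gt_eqF. Qed.

Let powR_gap (m k : nat) : `|(m + k)%:R * dlt - m%:R * dlt| `^ al = q k * dlt `^ al.
Proof.
rewrite natrD mulrDl addrC addKr ger0_norm ?mulr_ge0//; last exact: ltW.
by rewrite powRM// ltW.
Qed.

Let C_diag i : C i i = dlt `^ al.
Proof.
rewrite /C !subrr normr0 powR0// (distrC (s i)) /t /s.
rewrite -[i.*2.+1]addn1 powR_gap /q powR1.
lra.
Qed.

(* [g k] is the covariance of increments at distance [2 (k + 1)]; as the first
   differences of [q] decrease, its sums are minorized by a telescoping sum. *)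
Let g (i : nat) : R := 2^-1 * (q i.*2.+3 + q i.*2.+1 - 2 * q i.*2.+2).

Let C_lt i k : C i (i + k.+1) = g k * dlt `^ al.
Proof.
rewrite /C /s /t.
have -> : (i + k.+1).*2.+1 = (i.*2 + k.*2.+3)%N by lia.
rewrite powR_gap.
have -> : (i.*2 + k.*2.+3 = i.*2.+1 + k.*2.+2)%N by lia.
rewrite powR_gap.
have -> : ((i + k.+1).*2 = i.*2.+1 + k.*2.+1)%N by lia.
rewrite powR_gap.
have -> : (i.*2.+1 + k.*2.+1 = i.*2 + k.*2.+2)%N by lia.
rewrite powR_gap /g; lra.
Qed.

Let g_sum n : 2^-1 * ((q n.*2.+2 - q n.*2.+1) - (q 2 - q 1)) <= \sum_(i < n) g i.
Proof.
elim: n => [|n IH]; first by rewrite big_ord0 subrr mulr0.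
rewrite big_ord_recr/= doubleS; apply: le_trans (lerD IH (lexx _)).
(* Concavity at 2n + 3 says that the next first difference of [q] is no larger than the one
   occurring in [g n]. *)
have := powR_midpoint_concave n.*2.+2 al01; rewrite -!/(q _) /g; lra.
Qed.

(** Reversing the order sorts the covariances by distance; the telescoped bound then applies, its
    leading difference being nonnegative since [q] increases. *)
Let row_ge n : - (2 `^ al - 1) / 2 * dlt `^ al <= \sum_(i < n) C i n.
Proof.
rewrite (reindex_inj rev_ord_inj)/=.
have -> : \sum_(i < n) C (n - i.+1) n = (\sum_(i < n) g i) * dlt `^ al.
  rewrite mulr_suml; apply: eq_bigr => i _; rewrite -(C_lt (n - i.+1)).
  congr C.
  by have := ltn_ord i; lia.
rewrite ler_wpM2r ?powR_ge0//; apply: le_trans (g_sum n).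
have : q n.*2.+1 <= q n.*2.+2.
  apply: ge0_ler_powR; rewrite ?nnegrE ?ler_nat//.
  by case/andP: al01 => /ltW.
by rewrite /q powR1; lra.
Qed.

(** A new increment adds its variance and twice its row of covariances, hence at least 1 - (2^al -
    1) times dlt^al. *)
Lemma alternating_variance_ge n :
  n%:R * (2 - 2 `^ al) * dlt `^ al <= \sum_(i < n) \sum_(j < n) C i j.
Proof.
elim: n => [|n IH]; first by rewrite big_ord0 !mul0r.
rewrite big_ord_recr/=.
under eq_bigr do rewrite big_ord_recr/=.
rewrite big_split/= big_ord_recr/= C_diag.
under [X in _ + (X + _)]eq_bigr do rewrite C_sym.
have := row_ge n; rewrite -(natr1 n) => h.
move: IH h; move: (\sum_(i < n) \sum_(j < n) C i j) (\sum_(i < n) C i n) => x y.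
by move: (n%:R) (2 `^ al) (dlt `^ al) => a b e; nra.
Qed.

End alternating_variance.

(** * Expected truncated variation *)

(* [X] may be nonmeasurable: the integral of a nonnegative function is defined
   as the supremum of the integrals of the simple functions below it. *)
Lemma ae_le_integral_majorant (d : measure_display) (T : measurableType d)
    (R : realType) (mu : {measure set T -> \bar R}) (X Y : T -> \bar R) :
  measurable_fun setT Y -> (forall w, 0 <= X w)%E -> (forall w, 0 <= Y w)%E ->
  {ae mu, forall w, (X w <= Y w)%E} ->
  (\int[mu]_w X w <= \int[mu]_w Y w)%E.
Proof.
move=> mY X0 Y0 [N [mN N0 XY]].
pose Z w := if w \in N then +oo%E else Y w.
have Z0 w : (0 <= Z w)%E by rewrite /Z; case: ifP.
have mZ : measurable_fun setT Z.
  apply: measurable_fun_ifT => //.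
  apply: (@measurable_fun_bool _ _ _ _ true).
  rewrite setTI (_ : _ @^-1` _ = N)//.
  by apply/seteqP; split => w /=; [move=> /set_mem|move=> /mem_set].
have -> : (\int[mu]_w Y w = \int[mu]_w Z w)%E.
  apply: ae_eq_integral => //; exists N; split => // w /= YZ.
  apply: contrapT => nN; apply: YZ => _; rewrite /Z; case: ifPn => //.
  by rewrite inE.
have XZ w : (X w <= Z w)%E.
  rewrite /Z; case: ifPn => [_|]; first exact: leey.
  rewrite notin_setE => nN; apply: contrapT => h; apply: nN.
  by apply: XY => /=.
rewrite !ge0_integralTE//; apply: le_ereal_sup => _ [h hX <-].
by exists h => // w; exact: le_trans (hX w) (XZ w).
Qed.

Lemma expRN_le_fact (R : realType) (p : nat) (x : R) : 0 < x ->
  expR (- x) <= p.+1`!%:R * x ^- p.+1.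
Proof.
move=> x0; have := expR_ge1Dxn p (ltW x0).
have f0 : 0 < (p.+1)`!%:R :> R by rewrite ltr0n fact_gt0.
have xp : 0 < x ^+ p.+1 by rewrite exprn_gt0.
rewrite expRN => h; rewrite -[leRHS]invrK invfM !invrK mulrC.
rewrite lef_pV2 ?posrE ?expR_gt0 ?divr_gt0//.
by apply: le_trans h; rewrite lerDr.
Qed.

(** Its square 2^(-H) is the factor by which the standard deviation of an increment shrinks when the
    mesh is halved. *)
Definition chain_ratio (R : realType) (H : R) : R := 2 `^ (- (H / 2)).

(** With r the chain ratio, the factor 1 - r normalizes the geometric shares to a total of c r,
    below [c]. *)
Definition chain_level (R : realType) (H c : R) (k : nat) : R :=
  c * (1 - chain_ratio H) * chain_ratio H ^+ k.+1.

Section expected_chaining.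
Variables (R : realType) (H : R).
Hypothesis H01 : 0 < H < 1.

Local Notation r := (chain_ratio H).

Lemma chaining_ratio : 0 < r < 1.
Proof.
rewrite powR_gt0//= /chain_ratio powRN invf_lt1 ?powR_gt0//.
rewrite -[ltLHS](powRr0 (2 : R)) /powR pnatr_eq0/= ltr_expR.
by rewrite ltr_pM2r ?ln_gt0 ?ltr1n// divr_gt0//; case/andP: H01.
Qed.

(** The exponential is dominated by the power p + 1 of r^k, with [p] such that r^(p+1) <= 1/4. The
    rate 4^(-k) leaves 2^(-k) after summation over the 2^k cells. *)
Lemma exp_chaining_decay : exists2 A : R, 0 < A &
  forall k, expR (- ((1 - r) / 2 * r ^- k)) <= A * 4 ^- k.
Proof.
have /andP[r0 r1] := chaining_ratio.
have [p rp] : exists p, r ^+ p.+1 <= 4^-1.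
  have : r ^+ n @[n --> \oo] --> 0 by apply: cvg_expr; rewrite ger0_norm// ltW.
  move=> /cvgrPdist_le /(_ 4^-1); rewrite invr_gt0 => /(_ (ltr0n _ _)).
  move=> [n _ h]; exists n; have := h n.+1 (leqnSn n) => /=.
  by rewrite sub0r normrN ger0_norm// exprn_ge0// ltW.
set kap := (1 - r) / 2; have kap0 : 0 < kap by rewrite divr_gt0// subr_gt0.
exists (p.+1`!%:R * kap ^- p.+1).
  by rewrite divr_gt0 ?exprn_gt0// ltr0n fact_gt0.
move=> k; apply: le_trans (expRN_le_fact p _) _.
  by rewrite mulr_gt0// invr_gt0 exprn_gt0.
rewrite -[leRHS]mulrA ler_wpM2l// exprMn invfM.
apply: ler_wpM2l; first by rewrite invr_ge0 exprn_ge0// ltW.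
rewrite exprVn invrK -exprM mulnC exprM -[4 ^- k]exprVn.
by rewrite lerXn2r// nnegrE ?exprn_ge0// ?invr_ge0// ltW.
Qed.

Lemma chaining_budget (c : R) K : 0 <= c -> \sum_(k < K) chain_level H c k <= c.
Proof.
have /andP[r0 r1] := chaining_ratio.
move=> c0; suff -> : \sum_(k < K) chain_level H c k = c * (r - r ^+ K.+1).
  rewrite -[leRHS]mulr1 ler_wpM2l// lerBlDr (le_trans (ltW r1))// lerDl.
  by rewrite exprn_ge0// ltW.
elim: K => [|K IH]; first by rewrite big_ord0 expr1 subrr mulr0.
by rewrite big_ord_recr/= IH /chain_level !exprS; ring.
Qed.

Section process.
Variables (d : measure_display) (T : measurableType d) (P : probability T R).
Variable W : R -> T -> R.
Hypothesis fW : fractional_brownian_motion P H W.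

Lemma fbm_increment_excess (s h c : R) : 0 <= s -> 0 < h ->
  (\int[P]_w (Num.max (`|W (s + h)%R w - W s w| - c) 0)%:E <=
   (2 * expR 8 * h `^ H * expR (- (c / h `^ H)))%:E)%E.
Proof.
move=> s0 h0; have sh0 : 0 <= s + h by rewrite addr_ge0// ltW.
have [[mG [m [sg lG]]] G0 G2] := fbm_increment fW s0 sh0.
have e : `|s + h - s| = h by rewrite addrC addKr ger0_norm// ltW.
rewrite e in G2.
have m0 := gaussian_centered mG lG G0 G2.
rewrite {}m0 in lG.
by apply: (gaussian_excess_le mG _ _ lG G2); exact: powR_gt0.
Qed.

End process.
End expected_chaining.

Lemma dyadic_scale_powR (R : realType) (H dlt : R) (k : nat) : 0 < dlt ->
  (dlt / 2 ^+ k) `^ H = dlt `^ H * (chain_ratio H ^+ k) ^+ 2.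
Proof.
move=> dlt0; rewrite powRM ?invr_ge0 ?exprn_ge0//; last exact: ltW.
congr (_ * _); rewrite -exprM -powR_invn// -powRrM.
rewrite -[RHS]powR_mulrn ?powR_ge0// -powRrM natrM.
by congr (_ `^ _); field.
Qed.

Section expected_level.
Variables (R : realType) (H : R).
Hypothesis H01 : 0 < H < 1.
Variables (d : measure_display) (T : measurableType d) (P : probability T R).
Variable W : R -> T -> R.
Hypothesis fW : fractional_brownian_motion P H W.
Variables (dlt c A : R).
Hypothesis dlt0 : 0 < dlt.
Hypothesis dltc : dlt `^ H <= c.
Hypothesis A0 : 0 < A.
Hypothesis decay : forall k,
  expR (- ((1 - chain_ratio H) / 2 * chain_ratio H ^- k)) <= A * 4 ^- k.

Let c0 : 0 < c.
Proof. by apply: lt_le_trans dltc; exact: powR_gt0. Qed.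

Let b k := 2 * expR 8 * c * (A * 4 ^- k.+1).

Let b_ge0 k : 0 <= b k.
Proof.
rewrite /b mulr_ge0//; first by rewrite mulr_ge0 ?ltW// mulr_ge0 ?expR_ge0.
by rewrite mulr_ge0 ?ltW// invr_ge0 exprn_ge0.
Qed.

(** With x = r^(k+1), the deviation h^H is dlt^H x^2 and the half share is c (1 - r) x / 2; as dlt^H
    <= c, their ratio is at least (1 - r) / (2 x), where [decay] applies. *)
Let level_bound k (h := dlt / 2 ^+ k.+1) :
  2 * expR 8 * h `^ H * expR (- (chain_level H c k / 2 / h `^ H)) <= b k.
Proof.
have /andP[r0 r1] := chaining_ratio H01.
have rk0 : 0 < chain_ratio H ^+ k.+1 by rewrite exprn_gt0.
have rk1 : chain_ratio H ^+ k.+1 <= 1 by rewrite exprn_ile1// ltW.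
have dH0 : 0 < dlt `^ H by exact: powR_gt0.
rewrite /h dyadic_scale_powR//; have := decay k.+1.
rewrite /chain_level /b; set rho := chain_ratio H; set x := rho ^+ k.+1.
rewrite -/rho -/x in rk0 rk1 *; set E := A * _ => hE.
have tau_le : dlt `^ H * x ^+ 2 <= c.
  by rewrite -[leRHS]mulr1 ler_pM ?powR_ge0 ?sqr_ge0// exprn_ile1// ltW.
have tau0 : 0 < dlt `^ H * x ^+ 2 by rewrite mulr_gt0// exprn_gt0.
apply: ler_pM; rewrite ?expR_ge0//.
- by rewrite mulr_ge0 ?powR_ge0 ?(ltW tau0)// mulr_ge0 ?expR_ge0.
- by rewrite ler_wpM2l// mulr_ge0 ?expR_ge0.
apply: le_trans hE; rewrite ler_expR lerN2 ler_pdivlMr//.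
have -> : (1 - rho) / 2 / x * (dlt `^ H * x ^+ 2) = (1 - rho) / 2 * x * dlt `^ H.
  by field; rewrite gt_eqF.
have -> : c * (1 - rho) * x / 2 = (1 - rho) / 2 * x * c by field.
by rewrite ler_wpM2l// mulr_ge0 ?(ltW rk0)// divr_ge0// subr_ge0 ltW.
Qed.

Lemma measurable_dyadic_fluct k j :
  measurable_fun setT (fun w => dyadic_fluct dlt (W^~ w) k j).
Proof.
by apply: measurable_funB; apply: (fbm_measurable fW); exact: dyadic_time_ge0.
Qed.

Let mexcess k j : measurable_fun setT (fun w =>
  (Num.max (`|dyadic_fluct dlt (W^~ w) k j| - chain_level H c k / 2) 0)%:E).
Proof.
apply/measurable_EFinP; apply: measurable_maxr => //.
apply: measurable_funB => //; apply: measurableT_comp => //.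
exact: measurable_dyadic_fluct.
Qed.

Let excess_ge0 k j (w : T) : (0 <=
  (Num.max (`|dyadic_fluct dlt (W^~ w) k j| - chain_level H c k / 2) 0)%:E)%E.
Proof. by rewrite lee_fin le_max lexx orbT. Qed.

Lemma expected_excess k j :
  (\int[P]_w (Num.max (`|dyadic_fluct dlt (W^~ w) k j| -
     chain_level H c k / 2) 0)%:E <= (b k)%:E)%E.
Proof.
have /andP[r0 r1] := chaining_ratio H01.
have ck0 : 0 <= chain_level H c k.
  by rewrite !mulr_ge0 ?subr_ge0 ?exprn_ge0// ltW.
have tE := dyadic_time_double dlt k j./2.
have := odd_double_half j; case: (odd j) => jE; last first.
  rewrite add0n in jE; rewrite (eq_integral (cst 0%E)).
    by rewrite integral0 lee_fin b_ge0.
  move=> w _; rewrite /dyadic_fluct -[in dyadic_time dlt k.+1 _]jE tE subrr normr0.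
  by rewrite sub0r max_r// oppr_le0 divr_ge0.
rewrite add1n in jE.
have {}tE : dyadic_time dlt k.+1 j = dyadic_time dlt k j./2 + dlt / 2 ^+ k.+1.
  by rewrite -tE -[in LHS]jE /dyadic_time -natr1; ring.
apply: le_trans (_ : _ <= (2 * expR 8 * (dlt / 2 ^+ k.+1) `^ H *
    expR (- (chain_level H c k / 2 / (dlt / 2 ^+ k.+1) `^ H)))%:E)%E _; last first.
  by rewrite lee_fin level_bound.
under eq_integral do rewrite /dyadic_fluct tE.
apply: (fbm_increment_excess fW); first exact: dyadic_time_ge0.
by rewrite divr_gt0// exprn_gt0.
Qed.

Lemma expected_chaining_term n0 k :
  (\int[P]_w (chaining_term dlt (chain_level H c) n0 (W^~ w) k)%:E <=
   (2 * expR 8 * (1 + 2 * A) * n0%:R * c / 2 ^+ k)%:E)%E.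
Proof.
have e8 : 0 <= expR (8 : R) by exact: expR_ge0.
case: k => [|k] /=.
  under eq_integral do rewrite -sumEFin.
  rewrite ge0_integral_sum//; last first.
    move=> j; apply/measurable_EFinP; apply: measurableT_comp => //.
    by apply: measurable_funB; apply: (fbm_measurable fW); exact: dyadic_time_ge0.
  apply: (@le_trans _ _ (\sum_(0 <= j < n0) (2 * expR 8 * c)%:E)%E).
    apply: lee_sum => j _.
    have tE : dyadic_time dlt 0 j.+1 = dyadic_time dlt 0 j + dlt.
      by rewrite /dyadic_time expr0 divr1 -(natr1 j) divr1; ring.
    (* Threshold 0 bounds the mean absolute increment. *)
    have := fbm_increment_excess fW 0 (dyadic_time_ge0 dlt0 0 j) dlt0.
    rewrite -tE mul0r oppr0 expR0 mulr1 => h.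
    apply: le_trans (_ : _ <= (2 * expR 8 * dlt `^ H)%:E)%E _; last first.
      by rewrite lee_fin ler_wpM2l// mulr_ge0.
    apply: le_trans h; rewrite le_eqVlt; apply/orP; left; apply/eqP.
    by apply: eq_integral => w _; rewrite addr0 max_l.
  rewrite sumEFin lee_fin sumr_const_nat subn0 expr0 divr1 -[_ *+ n0]mulr_natr.
  have -> : 2 * expR 8 * (1 + 2 * A) * n0%:R * c =
    2 * expR 8 * c * n0%:R + A * (4 * expR 8 * n0%:R * c) by ring.
  rewrite lerDl; apply: mulr_ge0; first exact: ltW.
  by rewrite !mulr_ge0// ltW.
under eq_integral do rewrite -sumEFin.
rewrite ge0_integral_sum//; last 2 first.
- move=> j; under eq_fun do rewrite EFinD.
  by apply: emeasurable_funD; exact: mexcess.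
- by move=> j w _; rewrite EFinD; apply: adde_ge0; exact: excess_ge0.
apply: (@le_trans _ _ (\sum_(0 <= j < n0 * 2 ^ k.+1) (b k + b k)%:E)%E).
  apply: lee_sum => j _.
  under eq_integral do rewrite EFinD.
  rewrite (ge0_integralD _ measurableT (fun w _ => excess_ge0 k j w) (mexcess k j)
    (fun w _ => excess_ge0 k j.+1 w) (mexcess k j.+1)).
  by rewrite EFinD leeD// expected_excess.
rewrite sumEFin lee_fin sumr_const_nat subn0 -[_ *+ (_ * _)]mulr_natr natrM natrX /b.
(* One factor cancels the number of cells, the other makes the levels summable. *)
have -> : 4 ^- k.+1 = (2 ^+ k.+1)^-1 * (2 ^+ k.+1)^-1 :> R.
  by rewrite -invfM -exprMn; congr (_ ^- _); ring.
have p0 : 0 < (2 : R) ^+ k.+1 by rewrite exprn_gt0.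
set p := 2 ^+ k.+1 in p0 *.
have -> : (2 * expR 8 * c * (A * (p^-1 * p^-1)) + 2 * expR 8 * c * (A * (p^-1 * p^-1))) * (n0%:R * p) =
  (2 * expR 8 * (2 * A) * n0%:R * c) / p by field; rewrite gt_eqF.
rewrite ler_pM2r ?invr_gt0// ler_pM2r//.
by rewrite ler_wpM2r// ler_wpM2l// ?mulr_ge0// lerDr.
Qed.

End expected_level.

(** The pathwise chaining bound, valid almost surely, is integrated term by term; the levels decay
    like 2^(-k), so their sum doubles the constant of [expected_chaining_term]. *)
Lemma expected_UTV_le (R : realType) (H : R) : 0 < H < 1 ->
  exists2 C0 : R, 0 < C0 &
  forall (d : measure_display) (T : measurableType d) (P : probability T R)
    (W : R -> T -> R), fractional_brownian_motion P H W ->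
  forall (n0 : nat) (dlt c : R), (0 < n0)%N -> 0 < dlt -> dlt `^ H <= c ->
  (\int[P]_w UTV c (W^~ w) 0 (n0%:R * dlt) <= (C0 * n0%:R * c)%:E)%E.
Proof.
move=> H01; have [A A0 decay] := exp_chaining_decay H01.
have /andP[r0 r1] := chaining_ratio H01.
have e8 : 0 < expR (8 : R) by exact: expR_gt0.
exists (4 * expR 8 * (1 + 2 * A)).
  by rewrite !mulr_gt0// addr_gt0// mulr_gt0.
move=> d T P W fW n0 dlt c n00 dlt0 dltc.
have c0 : 0 < c by apply: lt_le_trans dltc; exact: powR_gt0.
have ck0 k : 0 <= chain_level H c k.
  rewrite /chain_level mulr_ge0 ?exprn_ge0//; last exact: ltW.
  by rewrite mulr_ge0 ?subr_ge0// ltW.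
pose Y w k := (chaining_term dlt (chain_level H c) n0 (W^~ w) k)%:E.
have Y0 w k : (0 <= Y w k)%E by rewrite lee_fin chaining_term_ge0.
have mW t : 0 <= t -> measurable_fun setT (W t) by exact: (fbm_measurable fW).
have mY k : measurable_fun setT (Y^~ k).
  apply/measurable_EFinP; case: k => [|k] /=.
    apply: measurable_sum => j; apply: measurableT_comp => //.
    by apply: measurable_funB; apply: mW; exact: dyadic_time_ge0.
  apply: measurable_sum => j; apply: measurable_funD; apply: measurable_maxr => //;
    apply: measurable_funB => //; apply: measurableT_comp => //;
    exact: (measurable_dyadic_fluct fW).
apply: (@le_trans _ _ (\int[P]_w \sum_(0 <= k <oo) Y w k)%E).
  apply: ae_le_integral_majorant.
  - exact: ge0_emeasurable_sum.
  - by move=> w; apply: UTV_ge0; rewrite mulr_gt0// ltr0n.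
  - by move=> w; apply: nneseries_ge0.
  - apply: filterS (fbm_continuous fW) => w cW.
    apply: UTV_le_chaining => // K; apply: chaining_budget => //.
    exact: ltW.
rewrite integral_nneseries//.
set B := 4 * expR 8 * (1 + 2 * A) * n0%:R * c.
apply: (@le_trans _ _ (\sum_(0 <= k <oo) (B / (2 ^ k.+1)%:R)%:E)%E); last first.
  by apply: epsilon_trick0; rewrite /B !mulr_ge0// ?ltW// addr_gt0// mulr_gt0.
apply: lee_nneseries; first by move=> k _ _; apply: integral_ge0.
move=> k _; apply: le_trans (expected_chaining_term _ fW dlt0 dltc A0 decay n0 k) _.
  exact: H01.
rewrite lee_fin /B natrX exprS invfM le_eqVlt; apply/orP; left; apply/eqP.
by field; rewrite expf_neq0.
Qed.

(** * Lower tail of the truncated variation *)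

Lemma two_powR_lt2 (R : realType) (a : R) : (2 `^ a < 2) = (a < 1).
Proof.
rewrite -[ltRHS]powRr1// /powR pnatr_eq0/= ltr_expR.
by rewrite ltr_pM2r ?ln_gt0 ?ltr1n.
Qed.

Lemma exists_nat_itv (R : realType) (x : R) : 1 <= x ->
  exists2 n : nat, (0 < n)%N & x <= n%:R <= 2 * x.
Proof.
move=> x1; have x0 : 0 <= x by lra.
exists (Num.truncn x).+1 => //.
have /andP[h1 h2] := truncn_itv x0; rewrite (ltW h2)/=.
by rewrite -(natr1 (Num.truncn x)); lra.
Qed.

(** The Gaussian tail bound improves with the variance, so the exact variance may be replaced by its
    minorant [V], positive because 2H < 1. *)
Lemma fbm_alternating_increments (R : realType) (H : R) (d : measure_display)
    (T : measurableType d) (P : probability T R) (W : R -> T -> R)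
    (n : nat) (dlt y : R) : 0 < H < 2^-1 ->
  fractional_brownian_motion P H W -> (0 < n)%N -> 0 < dlt -> 0 <= y ->
  let G := fun w => \sum_(i < n) (W (i.*2.+1%:R * dlt) w - W (i.*2%:R * dlt) w) in
  let V := n%:R * (2 - 2 `^ (2 * H)) * dlt `^ (2 * H) in
  measurable_fun setT G /\
  ((2^-1 * expR (- (2 + 16 * y ^+ 2 / V)))%:E <= P (G @^-1` `]y, +oo[))%E.
Proof.
move=> /andP[H0 H2] fW n0 dlt0 y0 G V.
have al01 : 0 < 2 * H <= 1 by apply/andP; split; lra.
have D0 : 0 < 2 - 2 `^ (2 * H) by rewrite subr_gt0 two_powR_lt2; lra.
have V0 : 0 < V by rewrite !mulr_gt0 ?ltr0n ?powR_gt0.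
have s0 (i : 'I_n) : 0 <= i.*2%:R * dlt by rewrite mulr_ge0// ltW.
have t0 (i : 'I_n) : 0 <= i.*2.+1%:R * dlt by rewrite mulr_ge0// ltW.
have [[mG [m [sg lG]]] G0] := fbm_increments fW s0 t0.
set V' := \sum_(i < n) _ => G2.
have VV' : V <= V' by exact: alternating_variance_ge.
have V'0 : 0 < V' by exact: lt_le_trans VV'.
have tau0 : 0 < Num.sqrt V' by rewrite sqrtr_gt0.
rewrite -[V'](sqr_sqrtr (ltW V'0)) in G2.
split => //.
have m0 := gaussian_centered mG lG G0 G2; rewrite {}m0 in lG.
apply: le_trans (gaussian_tail_ge mG tau0 y0 lG G2).
rewrite lee_fin ler_wpM2l// ler_expR lerN2 lerD2l sqr_sqrtr ?(ltW V'0)//.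
by rewrite ler_wpM2l ?mulr_ge0 ?sqr_ge0// lef_pV2 ?posrE.
Qed.

Theorem mainTheorem6 (R : realType) (H : R) (hH : 0 < H < 2^-1) :
  exists2 T_H : R, 0 < T_H &
  forall (d : measure_display) (Omega : measurableType d)
    (P : probability Omega R) (W : R -> Omega -> R),
  fractional_brownian_motion P H W ->
  forall S c v : R, 0 < S -> 0 < c <= S `^ H -> 1 <= v ->
  let X := fun w : Omega => UTV c (fun t => W t w) 0 S in
  ((2^-1 * expR (- (T_H * (S * c `^ (- H^-1) * v `^ (1 + 2 * H)))))%:E <=
   inner_prob P
     [set w | (S * c `^ (1 - H^-1) * v)%:E < `| X w - \int[P]_w' X w' |])%E.
Proof.
have /andP[H0 H2] := hH.
have H01 : 0 < H < 1 by rewrite H0/=; lra.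
have Hn0 : H != 0 by rewrite gt_eqF.
have [C0 C00 mean_le] := expected_UTV_le H01.
pose D := 2 - 2 `^ (2 * H).
have D0 : 0 < D by rewrite subr_gt0 two_powR_lt2; lra.
(* In units of N v c, the threshold [y] below has contributions 2 from n c, 2 C0 from [M], and 1
   from the deviation itself. *)
pose K := 3 + 2 * C0.
have four0 : 0 < 4 `^ (2 * H) :> R by rewrite powR_gt0.
(* The summand 2 absorbs the additive constant of the tail exponent, the other bounds 16 y^2 / V. *)
exists (2 + 16 * K ^+ 2 * 4 `^ (2 * H) / D).
  rewrite ltr_wpDr// divr_ge0 ?(ltW D0)// mulr_ge0 ?(ltW four0)//.
  by rewrite mulr_ge0// sqr_ge0.
move=> d Omega P W fW S c v S0 /andP[c0 cS] v1; cbv zeta.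
set X := (fun w : Omega => UTV c _ 0 S).
have v0 : 0 < v by lra.
(* The real number of cells of length c^(1/H) in [0, S]; it is at least 1 because c <= S^H. *)
have [N NE] : exists N, N = S * c `^ (- H^-1) by eexists.
have cH0 : 0 < c `^ H^-1 by exact: powR_gt0.
have SN : S = N * c `^ H^-1 by rewrite NE powRN divfK// gt_eqF.
have N1 : 1 <= N.
  rewrite NE powRN ler_pdivlMr// mul1r.
  have -> : S = (S `^ H) `^ H^-1 by rewrite -powRrM divff// powRr1// ltW.
  by apply: ge0_ler_powR; rewrite ?nnegrE ?powR_ge0 ?invr_ge0 ?(ltW H0) ?(ltW c0).
have N0 : 0 < N by lra.
have cE : S * c `^ (1 - H^-1) = N * c.
  rewrite powRD; last by rewrite (gt_eqF c0) implybT.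
  by rewrite powRr1 ?(ltW c0)// NE; ring.
(* A mesh of n0 cells with N <= n0 <= 2N satisfies the hypothesis of the mean bound and loses only a
   factor 2. *)
pose M := 2 * C0 * N * c.
have XM : (\int[P]_w X w <= M%:E)%E.
  have [n0 n0_gt0 /andP[n1 n2]] := exists_nat_itv N1.
  have n00 : 0 < n0%:R :> R by rewrite ltr0n.
  have dltc : (S / n0%:R) `^ H <= c.
    have -> : c = (c `^ H^-1) `^ H by rewrite -powRrM mulVf// powRr1// ltW.
    apply: ge0_ler_powR; rewrite ?nnegrE ?(ltW H0) ?(ltW cH0) ?divr_ge0 ?(ltW S0)//.
    by rewrite ler_pdivrMr// {1}SN mulrC ler_wpM2l// ltW.
  have := mean_le _ _ _ _ fW n0 (S / n0%:R) c n0_gt0 (divr_gt0 S0 n00) dltc.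
  rewrite mulrC divfK ?gt_eqF// => /le_trans; apply.
  rewrite lee_fin /M ler_wpM2r ?(ltW c0)// [2 * C0]mulrC -mulrA.
  by rewrite ler_wpM2l// ltW.
have X0 : (0 <= \int[P]_w X w)%E by apply: integral_ge0 => w _; exact: UTV_ge0.
have Xfin : (\int[P]_w X w)%E \is a fin_num.
  by rewrite ge0_fin_numE// (le_lt_trans XM)// ltry.
have Nv1 : 1 <= N * v by rewrite -[leLHS]mulr1 ler_pM.
have Nv0 : 0 < N * v by lra.
have [n n_gt0 /andP[n1 n2]] := exists_nat_itv Nv1.
have n0 : 0 < n%:R :> R by rewrite ltr0n.
pose dlt := S / (2 * n%:R).
have dlt0 : 0 < dlt by rewrite divr_gt0// mulr_gt0.
(* G > y pays for the n truncations and for the mean, and still leaves a deviation above N c v. *)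
pose y := n%:R * c + M + N * c * v.
have M0 : 0 <= M by rewrite ltW// /M !mulr_gt0.
have y0 : 0 <= y.
  by rewrite /y !addr_ge0// ltW// ?mulr_gt0.
have [mG tail] := fbm_alternating_increments hH fW n_gt0 dlt0 y0.
move: mG tail; set G := (fun w : Omega => _ : R); set V := (X in 16 * _ / X) => mG tail.
(* This event is measurable and contained in the deviation event, hence a competitor for the inner
   probability. *)
apply: (@le_trans _ _ (P (G @^-1` `]y, +oo[))); last first.
  apply: ereal_sup_ubound; exists (G @^-1` `]y, +oo[) => //; split.
    by rewrite -[X in measurable X]setTI; apply: mG => //; exact: measurable_itv.
  move=> w /=; rewrite in_itv/= andbT => yG.
  have XG : ((G w - n%:R * c)%:E <= X w)%E.
    apply: (@UTV_ge _ c (W^~ w) 0 S n (fun i => i.*2%:R * dlt)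
      (fun i => i.*2.+1%:R * dlt)) => //.
    - by rewrite mul0r.
    - rewrite /dlt mulrA ler_pdivrMr ?mulr_gt0// mulrC ler_wpM2l ?(ltW S0)//.
      by rewrite -(natrM _ 2 n) ler_nat; move: n_gt0; clear; lia.
    - by move=> i _; rewrite (ltr_pM2r dlt0) ltr_nat.
    - by move=> i _; rewrite (ltr_pM2r dlt0) ltr_nat doubleS.
  move: XM; rewrite -(fineK Xfin); set m := fine _; rewrite lee_fin => mM.
  apply: lt_le_trans (lee_abs _).
  apply: lt_le_trans (leeB XG (lexx _)).
  rewrite -EFinB lte_fin cE; move: yG; rewrite /y; lra.
apply: le_trans tail; rewrite lee_fin ler_wpM2l// ler_expR lerN2.
have Q1 : 1 <= N * v `^ (1 + 2 * H).
  rewrite -[leLHS]mulr1 ler_pM// -[leLHS](powRr0 v).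
  by apply: ler_powR => //; lra.
have yK : y <= K * (N * v * c).
  have cNv : N * c * 1 <= N * c * v by rewrite ler_wpM2l// mulr_ge0// ltW.
  have : C0 * (N * c * 1) <= C0 * (N * c * v) by rewrite ler_wpM2l// ltW.
  have : n%:R * c <= 2 * (N * v) * c by rewrite ler_wpM2r// ltW.
  by rewrite /y /M /K; lra.
have y2 : y ^+ 2 <= K ^+ 2 * (N * v * c) ^+ 2.
  by rewrite -exprMn ler_pXn2r// nnegrE (le_trans y0).
(* From n >= N v, and from n <= 2 N v, which gives dlt = S / (2n) >= c^(1/H) / (4v). *)
pose V1 := N * v * D * (c ^+ 2 / (4 `^ (2 * H) * v `^ (2 * H))).
have vH0 : 0 < v `^ (2 * H) by exact: powR_gt0.
have V10 : 0 < V1 by rewrite !mulr_gt0 ?invr_gt0 ?mulr_gt0// exprn_gt0.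
have fv0 : 0 < 4 * v by rewrite mulr_gt0.
have V1V : V1 <= V.
  rewrite /V1 /V -/D; apply: ler_pM.
  - by rewrite ltW// mulr_gt0.
  - by rewrite divr_ge0 ?sqr_ge0// ltW// mulr_gt0.
  - by rewrite ler_wpM2r// ltW.
  have -> : c ^+ 2 / (4 `^ (2 * H) * v `^ (2 * H)) = (c `^ H^-1 / (4 * v)) `^ (2 * H).
    rewrite [RHS]powRM ?(ltW cH0) ?invr_ge0 ?(ltW fv0)//.
    rewrite -powRrM mulrCA mulVf// mulr1 (powR_mulrn 2 (ltW c0)); congr (_ * _).
    rewrite -(powR_inv1 (ltW fv0)) -powRrM mulN1r powRN powRM//.
    exact: ltW.
  apply: ge0_ler_powR; rewrite ?nnegrE ?(ltW dlt0) ?(ltW (divr_gt0 cH0 fv0))//.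
    by rewrite mulr_ge0// ltW.
  rewrite /dlt ler_pdivrMr ?mulr_gt0// mulrAC ler_pdivlMr ?mulr_gt0//.
  rewrite SN [leRHS]mulrC; move: (c `^ H^-1) cH0 n2 => e e0 n2.
  have : e * (n%:R) <= e * (2 * (N * v)) by rewrite ler_wpM2l// ltW.
  by lra.
have ratio : 16 * y ^+ 2 / V <= 16 * K ^+ 2 * 4 `^ (2 * H) / D * (N * v `^ (1 + 2 * H)).
  apply: (@le_trans _ _ (16 * (K ^+ 2 * (N * v * c) ^+ 2) / V1)).
    apply: ler_pM; rewrite ?mulr_ge0 ?invr_ge0 ?sqr_ge0//.
    - by rewrite (le_trans (ltW V10)).
    - by rewrite ler_wpM2l.
    - by rewrite lef_pV2 ?posrE// (lt_le_trans V10).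
  rewrite powRD; last by rewrite (gt_eqF v0) implybT.
  rewrite powRr1 ?(ltW v0)// /V1 le_eqVlt; apply/orP; left; apply/eqP.
  move: (4 `^ _) (v `^ _) four0 vH0 => f g f0 g0.
  by field; rewrite !gt_eqF.
rewrite -NE [leRHS]mulrDl; apply: lerD => //.
by rewrite -[leLHS]mulr1 ler_wpM2l.
Qed.
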